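(* Let $\mathbb K$ be a field, let $M$ be a finitely generated, commutative, reduced, torsion-free and cancellative binoid and let $\mathbb K[M]$ be its binoid algebra. Then there is an isomorphism of sheaves of abelian groups on $\operatorname{Spec}\mathbb K[M]$ equipped with the combinatorial topology $$(\mathcal O^*_{\mathbb K[M]})^{\mathrm{comb}}\cong(i_*\mathcal O^*_M)^{\mathrm{comb}}\oplus(\mathbb K^* )^{\mathrm{comb}},$$ where $\mathbb K^*$ is the constant sheaf and $i:\operatorname{Spec}M\to\operatorname{Spec}\mathbb K[M]$ is the map $\mathfrak p\mapsto\mathbb K[\mathfrak p]$.
   Context: A binoid $(M,+,0,\infty)$ is a commutative monoid with an absorbing element $\infty$; $M^*$ is its group of units. $M$ is cancellative if $a+x=a+y\neq\infty$ implies $x=y$; torsion-free if $nx=ny\ne\infty$ for some $n\ge1$ implies $x=y$; reduced if $nf=\infty$ for some $n\ge1$ implies $f=\infty$. An ideal is a subset $I\ni\infty$ with $M+I\subseteq I$; it is prime if $I\ne M$ and $a+b\in I$ implies $a\in I$ or $b\in I$. $\operatorname{Spec}M$ is the set of prime ideals with the topology having basis $D(f)=\{\mathfrak p\mid f\notin\mathfrak p\}$. The structure sheaf $\mathcal O_M$ is the sheaf of binoids associated to $D(f)\mapsto M_f$ (localization) and $\mathcal O^*_M(U)=(\mathcal O_M(U))^*$. $\mathbb K[M]$ is the $\mathbb K$-algebra with $\mathbb K$-basis $T^\mu$, $\mu\in M\setminus\{\infty\}$, multiplication $T^\mu T^\nu=T^{\mu+\nu}$, and $T^\infty=0$. For an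 ideal $I\subseteq M$, $\mathbb K[I]$ is the ideal of $\mathbb K[M]$ spanned by $T^\mu$, $\mu\in I$; ideals of this form are called combinatorial. Under these hypotheses $\mathbb K[\mathfrak p]$ is prime for $\mathfrak p$ prime, and $i$ is continuous for the Zariski topologies. The combinatorial topology on $\operatorname{Spec}\mathbb K[M]$ has as open sets the sets $D(\mathfrak A)$ (complement of $V(\mathfrak A)$) with $\mathfrak A$ a combinatorial ideal; it is coarser than the Zariski topology. For a Zariski sheaf $\mathscr F$, $\mathscr F^{\mathrm{comb}}$ denotes its restriction to the combinatorial open sets. $\mathcal O^*_{\mathbb K[M]}$ is the (Zariski) sheaf of units of the structure sheaf of $\operatorname{Spec}\mathbb K[M]$. *)

(* Defs.v *)
From HB Require Import structures.
From mathcomp Require Import all_boot all_order all_algebra finmap.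
From mathcomp Require Import boolp classical_sets topology.
From mathcomp Require Import monalg.
From mathcomp Require Import ring.

Set Implicit Arguments.
Unset Strict Implicit.
Unset Printing Implicit Defensive.

Import GRing.Theory.

Local Open Scope ring_scope.
Local Open Scope classical_set_scope.
Local Open Scope quotient_scope.

HB.mixin Record Nmodule_isBinoid M of GRing.Nmodule M := {
  binf : M;
  addrbinf : forall x : M, x + binf = binf
}.

#[short(type="binoidType")]
HB.structure Definition Binoid := { M of Nmodule_isBinoid M & GRing.Nmodule M }.

Arguments binf {s}.

Section BinoidPredicates.
Variable M : binoidType.
Implicit Types (a x y : M) (I : set M).

Definition binoid_cancellative :=
  forall a x y, a + x = a + y -> a + x <> binf -> x = y.

Definition binoid_torsion_free :=
  forall (n : nat) x y, (0 < n)%N -> x *+ n = y *+ n -> x *+ n <> binf -> x = y.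

Definition binoid_reduced :=
  forall (n : nat) x, (0 < n)%N -> x *+ n = binf -> x = binf.

(* [binf] is part of the binoid structure, so it need not be generated. *)
Definition binoid_fg :=
  exists s : seq M, forall x, x = binf \/
    exists k : nat -> nat, x = \sum_(i < size s) s`_i *+ k i.

Definition binoid_ideal I := I binf /\ forall a x, I x -> I (a + x).

Definition binoid_prime I :=
  [/\ binoid_ideal I, I <> setT & forall a b, I (a + b) -> I a \/ I b].

End BinoidPredicates.

Record bspec (M : binoidType) := BSpec {
  bspec_set :> M -> Prop;
  bspecP : binoid_prime bspec_set
}.

HB.instance Definition _ (M : binoidType) := gen_eqMixin (bspec M).
HB.instance Definition _ (M : binoidType) := gen_choiceMixin (bspec M).

Definition bspec_D (M : binoidType) (f : M) : set (bspec M) :=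
  [set p | ~ p f].

Section BSpecTheory.
Variable M : binoidType.
Implicit Types p : bspec M.

Lemma bprime_inf p : p binf. Proof. by have [[]] := bspecP p. Qed.

Lemma bprime0 p : ~ p 0.
Proof.
have [[_ pD] pT _] := bspecP p => p0; apply: pT.
by rewrite -subTset => x _; rewrite -[x]addr0; apply: pD.
Qed.

Lemma bprimeD p x y : ~ p x -> ~ p y -> ~ p (x + y).
Proof. by have [_ _ pp] := bspecP p => px py /pp[]. Qed.

Lemma bprimeDl p x y : ~ p (x + y) -> ~ p x.
Proof. by have [[_ pD] _ _] := bspecP p => pxy px; apply: pxy; rewrite addrC; apply: pD. Qed.

Lemma bprimeDr p x y : ~ p (x + y) -> ~ p y.
Proof. by rewrite addrC; apply: bprimeDl. Qed.

Definition bspec_open (U : set (bspec M)) :=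
  exists S : set M, U = \bigcup_(f in S) bspec_D f.

Lemma bspec_openP U :
  bspec_open U <-> forall p, U p -> exists2 f, ~ p f & bspec_D f `<=` U.
Proof.
split=> [[S ->] p [f Sf pf]|hU]; first by exists f => // q qf; exists f.
exists [set f | bspec_D f `<=` U]; apply/seteqP; split=> [p /hU[f pf fU]|p [f fU]].
  by exists f.
exact: fU.
Qed.

Lemma bspec_openT : bspec_open setT.
Proof. by apply/bspec_openP => p _; exists 0 => //; apply: bprime0. Qed.

Lemma bspec_openI : setI_closed bspec_open.
Proof.
move=> U V /bspec_openP hU /bspec_openP hV; apply/bspec_openP => p [Up Vp].
have [f pf fU] := hU p Up; have [g pg gV] := hV p Vp.
exists (f + g); first exact: bprimeD.
by move=> q qfg; split; [apply/fU/(bprimeDl qfg)|apply/gV/(bprimeDr qfg)].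
Qed.

Lemma bspec_open_bigU (I : Type) (U : I -> set (bspec M)) :
  (forall i, bspec_open (U i)) -> bspec_open (\bigcup_i U i).
Proof.
move=> hU; apply/bspec_openP => p [i _ Up].
have /bspec_openP/(_ p Up)[f pf fU] := hU i.
by exists f => // q /fU Uq; exists i.
Qed.

HB.instance Definition _ := isOpenTopological.Build (bspec M)
  bspec_openT bspec_openI bspec_open_bigU.

End BSpecTheory.

Section BinoidLocalization.
Variables (M : binoidType) (p : bspec M).

(* M_p: fractions m - s with s outside p, where m - s = m' - s' iff
   u + m + s' = u + m' + s for some u outside p. *)
Definition bden := {s : M | `[< ~ p s >]}.

Lemma bdenP (s : bden) : ~ p (val s). Proof. exact/asboolP/(valP s). Qed.

Definition bloc_rel (x y : M * bden) : bool :=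
  `[< exists2 u, ~ p u & u + (x.1 + val y.2) = u + (y.1 + val x.2) >].

Lemma bloc_rel_equiv : equiv_class_of bloc_rel.
Proof.
split=> [x|x y|y x z].
- by apply/asboolP; exists 0 => //; apply: bprime0.
- by apply/asboolP/asboolP => -[u pu e]; exists u.
move=> /asboolP[u pu e] /asboolP[v pv e']; apply/asboolP.
exists (u + v + val y.2); first exact: bprimeD (bprimeD pu pv) (@bdenP y.2).
move: x.1 y.1 z.1 (val x.2) (val y.2) (val z.2) e e' => a b c s t r e e'.
rewrite [LHS](AC (3*2) ((1*(4*3))*(2*5))) /= e.
rewrite [LHS](AC ((1*2)*2) ((4*(2*5))*(1*3))) /= e'.
by rewrite [LHS](AC ((1*2)*2) ((4*1*3)*(2*5))) /=.
Qed.

Canonical bloc_equiv := EquivRelPack bloc_rel_equiv.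

Definition bloc := {eq_quot bloc_equiv}.
HB.instance Definition _ := Choice.on bloc.

Definition bfrac (m s : M) (ps : ~ p s) : bloc :=
  \pi_bloc (m, exist _ s (asboolT ps)).

Lemma bfracP (m s m' s' : M) (ps : ~ p s) (ps' : ~ p s') :
  bfrac m ps = bfrac m' ps' <->
  exists2 u, ~ p u & u + (m + s') = u + (m' + s).
Proof.
split=> [/eqmodP/asboolP|h]; first exact.
exact/eqmodP/asboolP.
Qed.

Lemma bfracE (m : M) (s : bden) (ps : ~ p (val s)) :
  bfrac m ps = \pi_bloc (m, s).
Proof. by rewrite /bfrac; congr (\pi_bloc (m, _)); apply: val_inj. Qed.

Lemma blocW (P : bloc -> Prop) :
  (forall m s (ps : ~ p s), P (bfrac m ps)) -> forall x, P x.
Proof.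
by move=> h; elim/quotW => -[m s]; rewrite -(bfracE m (@bdenP s)); apply: h.
Qed.

Definition bloc_num (x : bloc) : M := (repr x).1.
Definition bloc_den (x : bloc) : M := val (repr x).2.

Lemma bloc_denP x : ~ p (bloc_den x). Proof. exact: (@bdenP). Qed.

Lemma bloc_frac x : bfrac (bloc_num x) (@bloc_denP x) = x.
Proof. by rewrite bfracE -[RHS]reprK -surjective_pairing. Qed.

Definition bloc_add (x y : bloc) : bloc :=
  bfrac (bloc_num x + bloc_num y) (bprimeD (@bloc_denP x) (@bloc_denP y)).

Lemma bloc_addE m s m' s' (ps : ~ p s) (ps' : ~ p s') :
  bloc_add (bfrac m ps) (bfrac m' ps') = bfrac (m + m') (bprimeD ps ps').
Proof.
rewrite /bloc_add; apply/bfracP.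
have /bfracP[u pu e] := bloc_frac (bfrac m ps).
have /bfracP[v pv e'] := bloc_frac (bfrac m' ps').
move: (bloc_num _) (bloc_den _) e => a b e.
move: (bloc_num _) (bloc_den _) e' => c d e'.
exists (u + v); first exact: bprimeD.
rewrite [LHS](AC (2*(2*2)) ((1*(3*5))*(2*(4*6)))) /= e e'.
by rewrite [RHS](AC (2*(2*2)) ((1*(3*5))*(2*(4*6)))).
Qed.

Definition bloc0 : bloc := bfrac 0 (@bprime0 M p).
Definition bloc_inf : bloc := bfrac binf (@bprime0 M p).

Lemma bloc_addA : associative bloc_add.
Proof.
elim/blocW => a s ps; elim/blocW => b t pt; elim/blocW => c r pr.
rewrite !bloc_addE; apply/bfracP; exists 0; first exact: bprime0.
by rewrite !addrA.
Qed.

Lemma bloc_addC : commutative bloc_add.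
Proof.
elim/blocW => a s ps; elim/blocW => b t pt.
rewrite !bloc_addE; apply/bfracP; exists 0; first exact: bprime0.
by rewrite (addrC b) (addrC t).
Qed.

Lemma bloc_add0 : left_id bloc0 bloc_add.
Proof.
elim/blocW => a s ps; rewrite bloc_addE; apply/bfracP.
by exists 0; rewrite ?add0r //; apply: bprime0.
Qed.

HB.instance Definition _ :=
  GRing.isNmodule.Build bloc bloc_addA bloc_addC bloc_add0.

Lemma bfracD m s m' s' (ps : ~ p s) (ps' : ~ p s') :
  bfrac m ps + bfrac m' ps' = bfrac (m + m') (bprimeD ps ps').
Proof. exact: bloc_addE. Qed.

Lemma bloc_addinf (x : bloc) : x + bloc_inf = bloc_inf.
Proof.
elim/blocW: x => a s ps; rewrite bfracD; apply/bfracP.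
exists 0; first exact: bprime0.
by rewrite !add0r addr0 addrbinf [binf + _]addrC addrbinf.
Qed.

HB.instance Definition _ := Nmodule_isBinoid.Build bloc bloc_addinf.

End BinoidLocalization.

Section RingPrimes.
Variable A : comPzRingType.
Implicit Types I : set A.

Definition ring_ideal I :=
  [/\ I 0, forall a b, I a -> I b -> I (a + b) & forall a b, I b -> I (a * b)].

Definition ring_prime I :=
  [/\ ring_ideal I, I <> setT & forall a b, I (a * b) -> I a \/ I b].

End RingPrimes.

Record rspec (A : comPzRingType) := RSpec {
  rspec_set :> A -> Prop;
  rspecP : ring_prime rspec_set
}.

HB.instance Definition _ (A : comPzRingType) := gen_eqMixin (rspec A).
HB.instance Definition _ (A : comPzRingType) := gen_choiceMixin (rspec A).

Definition rspec_D (A : comPzRingType) (I : set A) : set (rspec A) :=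
  [set P | ~ (I `<=` P)].

Section RSpecTheory.
Variable A : comPzRingType.
Implicit Types P : rspec A.

Lemma rprime0 P : P 0. Proof. by have [[]] := rspecP P. Qed.

Lemma rprime1 P : ~ P 1.
Proof.
have [[_ _ PM] PT _] := rspecP P => P1; apply: PT.
by rewrite -subTset => x _; rewrite -[x]mulr1; apply: PM.
Qed.

Lemma rprimeM P x y : ~ P x -> ~ P y -> ~ P (x * y).
Proof. by have [_ _ Pp] := rspecP P => Px Py /Pp[]. Qed.

Lemma rprimeMl P x y : ~ P (x * y) -> ~ P x.
Proof.
by have [[_ _ PM] _ _] := rspecP P => Pxy Px; apply: Pxy; rewrite mulrC; apply: PM.
Qed.

Lemma rprimeMr P x y : ~ P (x * y) -> ~ P y.
Proof. by rewrite mulrC; apply: rprimeMl. Qed.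

Lemma rspec_DP I P : rspec_D I P <-> exists2 a, I a & ~ P a.
Proof.
split=> [/existsNP[a /not_implyP[Ia Pa]]|[a Ia Pa] /(_ a Ia)//].
by exists a.
Qed.

Definition rspec_open (U : set (rspec A)) :=
  exists2 I, ring_ideal I & U = rspec_D I.

Lemma rspec_openP U : rspec_open U <->
  forall P, U P -> exists2 a, ~ P a & forall Q : rspec A, ~ Q a -> U Q.
Proof.
split=> [[I _ ->] P /rspec_DP[a Ia Pa]|hU].
  by exists a => // Q Qa; apply/rspec_DP; exists a.
exists [set a | forall Q : rspec A, ~ Q a -> U Q]; last first.
  apply/seteqP; split=> [P /hU[a Pa aU]|P /rspec_DP[a aU Pa]]; last exact: aU.
  by apply/rspec_DP; exists a.
split=> [Q []|a b aU bU Q Qab|a b bU Q Qab]; first exact: rprime0.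
  have [Qa|Qa] := pselect (Q a); last exact: aU.
  apply: bU => Qb; apply: Qab.
  by have [[_ QD _] _ _] := rspecP Q; apply: QD.
exact: bU (rprimeMr Qab).
Qed.

Lemma rspec_openT : rspec_open setT.
Proof. by apply/rspec_openP => P _; exists 1 => //; apply: rprime1. Qed.

Lemma rspec_openI : setI_closed rspec_open.
Proof.
move=> U V /rspec_openP hU /rspec_openP hV; apply/rspec_openP => P [UP VP].
have [a Pa aU] := hU P UP; have [b Pb bV] := hV P VP.
exists (a * b); first exact: rprimeM.
by move=> Q Qab; split; [apply/aU/(rprimeMl Qab)|apply/bV/(rprimeMr Qab)].
Qed.

Lemma rspec_open_bigU (I : Type) (U : I -> set (rspec A)) :
  (forall i, rspec_open (U i)) -> rspec_open (\bigcup_i U i).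
Proof.
move=> hU; apply/rspec_openP => P [i _ UP].
have /rspec_openP/(_ P UP)[a Pa aU] := hU i.
by exists a => // Q /aU UQ; exists i.
Qed.

HB.instance Definition _ := isOpenTopological.Build (rspec A)
  rspec_openT rspec_openI rspec_open_bigU.

End RSpecTheory.

Section RingLocalization.
Variables (A : comPzRingType) (P : rspec A).

Definition rden := {s : A | `[< ~ P s >]}.

Lemma rdenP (s : rden) : ~ P (val s). Proof. exact/asboolP/(valP s). Qed.

Definition rloc_rel (x y : A * rden) : bool :=
  `[< exists2 u, ~ P u & u * (x.1 * val y.2) = u * (y.1 * val x.2) >].

Lemma rloc_rel_equiv : equiv_class_of rloc_rel.
Proof.
split=> [x|x y|y x z].
- by apply/asboolP; exists 1 => //; apply: rprime1.
- by apply/asboolP/asboolP => -[u Pu e]; exists u.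
move=> /asboolP[u Pu e] /asboolP[v Pv e']; apply/asboolP.
exists (u * v * val y.2); first exact: rprimeM (rprimeM Pu Pv) (@rdenP y.2).
move: x.1 y.1 z.1 (val x.2) (val y.2) (val z.2) e e' => a b c s t r e e'.
transitivity ((u * (a * t)) * (v * r)); first by ring.
rewrite e; transitivity ((v * (b * r)) * (u * s)); first by ring.
by rewrite e'; ring.
Qed.

Canonical rloc_equiv := EquivRelPack rloc_rel_equiv.

Definition rloc := {eq_quot rloc_equiv}.
HB.instance Definition _ := Choice.on rloc.

Definition rfrac (a s : A) (Ps : ~ P s) : rloc :=
  \pi_rloc (a, exist _ s (asboolT Ps)).

Lemma rfracP (a s a' s' : A) (Ps : ~ P s) (Ps' : ~ P s') :
  rfrac a Ps = rfrac a' Ps' <->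
  exists2 u, ~ P u & u * (a * s') = u * (a' * s).
Proof.
split=> [/eqmodP/asboolP|h]; first exact.
exact/eqmodP/asboolP.
Qed.

Lemma rfracE (a : A) (s : rden) (Ps : ~ P (val s)) :
  rfrac a Ps = \pi_rloc (a, s).
Proof. by rewrite /rfrac; congr (\pi_rloc (a, _)); apply: val_inj. Qed.

Lemma rlocW (Q : rloc -> Prop) :
  (forall a s (Ps : ~ P s), Q (rfrac a Ps)) -> forall x, Q x.
Proof.
by move=> h; elim/quotW => -[a s]; rewrite -(rfracE a (@rdenP s)); apply: h.
Qed.

Definition rloc_num (x : rloc) : A := (repr x).1.
Definition rloc_den (x : rloc) : A := val (repr x).2.

Lemma rloc_denP x : ~ P (rloc_den x). Proof. exact: (@rdenP). Qed.

Lemma rloc_frac x : rfrac (rloc_num x) (@rloc_denP x) = x.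
Proof. by rewrite rfracE -[RHS]reprK -surjective_pairing. Qed.

Definition rloc_add (x y : rloc) : rloc :=
  rfrac (rloc_num x * rloc_den y + rloc_num y * rloc_den x)
    (rprimeM (@rloc_denP x) (@rloc_denP y)).
Definition rloc_mul (x y : rloc) : rloc :=
  rfrac (rloc_num x * rloc_num y) (rprimeM (@rloc_denP x) (@rloc_denP y)).
Definition rloc_opp (x : rloc) : rloc :=
  rfrac (- rloc_num x) (@rloc_denP x).
Definition rloc0 : rloc := rfrac 0 (@rprime1 A P).
Definition rloc1 : rloc := rfrac 1 (@rprime1 A P).

Lemma rloc_addE a s b t (Ps : ~ P s) (Pt : ~ P t) :
  rloc_add (rfrac a Ps) (rfrac b Pt) = rfrac (a * t + b * s) (rprimeM Ps Pt).
Proof.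
rewrite /rloc_add; apply/rfracP.
have /rfracP[u Pu e] := rloc_frac (rfrac a Ps).
have /rfracP[v Pv e'] := rloc_frac (rfrac b Pt).
move: (rloc_num _) (rloc_den _) e => a' s' e.
move: (rloc_num _) (rloc_den _) e' => b' t' e'.
exists (u * v); first exact: rprimeM.
transitivity (u * (a' * s) * (v * t * t') + v * (b' * t) * (u * s * s')); first by ring.
by rewrite e e'; ring.
Qed.

Lemma rloc_mulE a s b t (Ps : ~ P s) (Pt : ~ P t) :
  rloc_mul (rfrac a Ps) (rfrac b Pt) = rfrac (a * b) (rprimeM Ps Pt).
Proof.
rewrite /rloc_mul; apply/rfracP.
have /rfracP[u Pu e] := rloc_frac (rfrac a Ps).
have /rfracP[v Pv e'] := rloc_frac (rfrac b Pt).
move: (rloc_num _) (rloc_den _) e => a' s' e.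
move: (rloc_num _) (rloc_den _) e' => b' t' e'.
exists (u * v); first exact: rprimeM.
transitivity (u * (a' * s) * (v * (b' * t))); first by ring.
by rewrite e e'; ring.
Qed.

Lemma rloc_oppE a s (Ps : ~ P s) : rloc_opp (rfrac a Ps) = rfrac (- a) Ps.
Proof.
rewrite /rloc_opp; apply/rfracP.
have /rfracP[u Pu e] := rloc_frac (rfrac a Ps).
by exists u => //; rewrite !mulNr !mulrN e.
Qed.

Let rlocE := (rloc_addE, rloc_mulE, rloc_oppE).

Ltac rloc_ring :=
  rewrite ?rlocE; apply/rfracP; exists 1; [exact: rprime1|by ring].

Lemma rloc_addA : associative rloc_add.
Proof.
elim/rlocW => a s ?; elim/rlocW => b t ?; elim/rlocW => c r ?; rloc_ring.
Qed.

Lemma rloc_addC : commutative rloc_add.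
Proof. elim/rlocW => a s ?; elim/rlocW => b t ?; rloc_ring. Qed.

Lemma rloc_add0 : left_id rloc0 rloc_add.
Proof. elim/rlocW => a s ?; rloc_ring. Qed.

Lemma rloc_addN : left_inverse rloc0 rloc_opp rloc_add.
Proof. elim/rlocW => a s ?; rloc_ring. Qed.

HB.instance Definition _ :=
  GRing.isZmodule.Build rloc rloc_addA rloc_addC rloc_add0 rloc_addN.

Lemma rloc_mulA : associative rloc_mul.
Proof.
elim/rlocW => a s ?; elim/rlocW => b t ?; elim/rlocW => c r ?; rloc_ring.
Qed.

Lemma rloc_mulC : commutative rloc_mul.
Proof. elim/rlocW => a s ?; elim/rlocW => b t ?; rloc_ring. Qed.

Lemma rloc_mul1 : left_id rloc1 rloc_mul.
Proof. elim/rlocW => a s ?; rloc_ring. Qed.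

Lemma rloc_mulD : left_distributive rloc_mul +%R.
Proof.
elim/rlocW => a s ?; elim/rlocW => b t ?; elim/rlocW => c r ?.
rewrite /GRing.add /=; rloc_ring.
Qed.

HB.instance Definition _ := GRing.Zmodule_isComPzRing.Build rloc
  rloc_mulA rloc_mulC rloc_mul1 rloc_mulD.

Lemma rfracD a s b t (Ps : ~ P s) (Pt : ~ P t) :
  rfrac a Ps + rfrac b Pt = rfrac (a * t + b * s) (rprimeM Ps Pt).
Proof. exact: rloc_addE. Qed.

Lemma rfracM a s b t (Ps : ~ P s) (Pt : ~ P t) :
  rfrac a Ps * rfrac b Pt = rfrac (a * b) (rprimeM Ps Pt).
Proof. exact: rloc_mulE. Qed.

Lemma rfracN a s (Ps : ~ P s) : - rfrac a Ps = rfrac (- a) Ps.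
Proof. exact: rloc_oppE. Qed.

End RingLocalization.

(* In [F : opens X -> Type] restriction maps take a proof of the inclusion as
   argument; by proof irrelevance they do not depend on it. *)
Record opens (X : topologicalType) := Opens {
  oset :> X -> Prop;
  osetP : open oset
}.

Lemma opens_eq (X : topologicalType) (U V : opens X) :
  oset U = oset V -> U = V.
Proof.
case: U V => U oU [V oV] /= e; move: e oU oV => -> oU oV.
by congr Opens; apply: Prop_irrelevance.
Qed.

Definition opensI (X : topologicalType) (U V : opens X) : opens X :=
  Opens (openI (osetP U) (osetP V)).

Section IsSheaf.
Variables (X : topologicalType) (F : opens X -> Type).
Variable (r : forall U V : opens X, V `<=` U -> F U -> F V).

Record is_sheaf : Prop := IsSheaf {
  sheaf_id : forall (U : opens X) (h : U `<=` U) s, r h s = s;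
  sheaf_comp : forall (U V W : opens X) (h : V `<=` U) (k : W `<=` V)
    (l : W `<=` U) s, r k (r h s) = r l s;
  sheaf_sep : forall (I : Type) (U : opens X) (V : I -> opens X)
    (h : forall i, V i `<=` U), U `<=` \bigcup_i V i ->
    forall s t : F U, (forall i, r (h i) s = r (h i) t) -> s = t;
  sheaf_glue : forall (I : Type) (U : opens X) (V : I -> opens X)
    (h : forall i, V i `<=` U), U `<=` \bigcup_i V i ->
    forall s : forall i, F (V i),
    (forall i j, r (@subIsetl _ (V i) (V j) : opensI (V i) (V j) `<=` V i) (s i)
               = r (@subIsetr _ (V i) (V j) : opensI (V i) (V j) `<=` V j) (s j)) ->
    exists t : F U, forall i, r (h i) t = s i
}.

End IsSheaf.

Record nsheaf (X : topologicalType) := NSheaf {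
  nsec :> opens X -> nmodType;
  nres : forall U V : opens X, V `<=` U -> nsec U -> nsec V;
  nres_morph : forall (U V : opens X) (h : V `<=` U), nmod_morphism (nres h);
  nsheafP : is_sheaf nres
}.

Record absheaf (X : topologicalType) := AbSheaf {
  absec :> opens X -> zmodType;
  abres : forall U V : opens X, V `<=` U -> absec U -> absec V;
  abres_morph : forall (U V : opens X) (h : V `<=` U),
    {morph abres h : s t / s + t};
  absheafP : is_sheaf abres
}.

Arguments nres_morph {X n U V} h.
Arguments abres_morph {X a U V} h.

Definition absheaf_isomorphic (X : topologicalType) (F G : absheaf X) :=
  exists phi : forall U : opens X, F U -> G U,
  [/\ forall U, {morph phi U : s t / s + t},
      forall U, bijective (phi U) &
      forall (U V : opens X) (h : V `<=` U) (s : F U),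
        phi V (abres h s) = abres h (phi U s)].

Section DirectSum.
Variables (X : topologicalType) (F G : absheaf X).

Definition dsum_sec (U : opens X) : zmodType := (F U * G U)%type.

Definition dsum_res (U V : opens X) (h : V `<=` U) (s : dsum_sec U) :
  dsum_sec V := (abres h s.1, abres h s.2).

Lemma dsum_morph (U V : opens X) (h : V `<=` U) :
  {morph dsum_res h : s t / s + t}.
Proof. by move=> s t; rewrite /dsum_res !abres_morph. Qed.

Lemma dsum_is_sheaf : is_sheaf dsum_res.
Proof.
have [idF compF sepF glueF] := absheafP F.
have [idG compG sepG glueG] := absheafP G.
split.
- by move=> U h [s t]; rewrite /dsum_res idF idG.
- by move=> U V W h k l [s t]; rewrite /dsum_res (compF _ _ _ _ _ l) (compG _ _ _ _ _ l).
- move=> I U V h UV [s1 s2] [t1 t2] e; congr (_, _).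
    by apply: (sepF _ _ _ h UV) => i; case: (e i).
  by apply: (sepG _ _ _ h UV) => i; case: (e i).
move=> I U V h UV s e.
have [i j|t1 e1] := glueF _ _ _ h UV (fun i => (s i).1).
  by case: (e i j).
have [i j|t2 e2] := glueG _ _ _ h UV (fun i => (s i).2).
  by case: (e i j).
by exists (t1, t2) => i; rewrite /dsum_res e1 e2 -surjective_pairing.
Qed.

Definition dsum : absheaf X := AbSheaf dsum_morph dsum_is_sheaf.

End DirectSum.

Section Pushforward.
Variables (X Y : topologicalType) (f : X -> Y) (cf : continuous f).

Definition preimo (U : opens Y) : opens X :=
  Opens ((continuousP f).1 cf U (osetP U)).

Lemma preimo_sub (U V : opens Y) : V `<=` U -> preimo V `<=` preimo U.
Proof. by move=> h x; apply: h. Qed.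

Variable F : absheaf X.

Definition push_sec (U : opens Y) : zmodType := F (preimo U).

Definition push_res (U V : opens Y) (h : V `<=` U) : push_sec U -> push_sec V :=
  abres (preimo_sub h).

Lemma push_morph (U V : opens Y) (h : V `<=` U) :
  {morph push_res h : s t / s + t}.
Proof. exact: abres_morph. Qed.

Lemma push_is_sheaf : is_sheaf push_res.
Proof.
have [idF compF sepF glueF] := absheafP F.
have cov I (U : opens Y) (V : I -> opens Y) : U `<=` \bigcup_i V i ->
    preimo U `<=` \bigcup_i preimo (V i).
  by move=> UV x /UV[i _ Vi]; exists i.
split.
- by move=> U h s; apply: idF.
- by move=> U V W h k l s; apply: compF.
- move=> I U V h UV s t e.
  exact: (sepF _ _ _ (fun i => preimo_sub (h i)) (cov _ _ _ UV)).
move=> I U V h UV s e.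
apply: (glueF _ _ _ (fun i => preimo_sub (h i)) (cov _ _ _ UV)) => i j.
have sI : opensI (preimo (V i)) (preimo (V j)) `<=` preimo (opensI (V i) (V j)).
  by [].
have el := compF _ _ _ (preimo_sub
  (@subIsetl _ (V i) (V j) : opensI (V i) (V j) `<=` V i)) sI (@subIsetl _ _ _) (s i).
have er := compF _ _ _ (preimo_sub
  (@subIsetr _ (V i) (V j) : opensI (V i) (V j) `<=` V j)) sI (@subIsetr _ _ _) (s j).
by rewrite -el -er; congr (abres sI); apply: e.
Qed.

Definition pushforward : absheaf Y := AbSheaf push_morph push_is_sheaf.

End Pushforward.

Record munits (N : nmodType) := MUnits {
  munits_val : N;
  munitsP : exists y, munits_val + y = 0
}.

Section Units.
Variable N : nmodType.
Implicit Types x y : munits N.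

Lemma munits_inj : injective (@munits_val N).
Proof.
case=> x hx [y hy] /= e; move: e hx hy => -> hx hy.
by congr MUnits; apply: Prop_irrelevance.
Qed.

HB.instance Definition _ := gen_eqMixin (munits N).
HB.instance Definition _ := gen_choiceMixin (munits N).

Lemma munits_addP x y : exists z, munits_val x + munits_val y + z = 0.
Proof.
have [x' ex] := munitsP x; have [y' ey] := munitsP y.
by exists (x' + y'); rewrite addrACA ex ey addr0.
Qed.

Lemma munits_oppP x : exists z, sval (cid (munitsP x)) + z = 0.
Proof. by exists (munits_val x); rewrite addrC; case: cid. Qed.

Definition munits_add x y := MUnits (munits_addP x y).
Definition munits_opp x := MUnits (munits_oppP x).
Definition munits0 := @MUnits N 0 (ex_intro _ 0 (addr0 0)).

Lemma munits_addA : associative munits_add.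
Proof. by move=> x y z; apply: munits_inj; rewrite /= addrA. Qed.
Lemma munits_addC : commutative munits_add.
Proof. by move=> x y; apply: munits_inj; rewrite /= addrC. Qed.
Lemma munits_add0 : left_id munits0 munits_add.
Proof. by move=> x; apply: munits_inj; rewrite /= add0r. Qed.
Lemma munits_addN : left_inverse munits0 munits_opp munits_add.
Proof. by move=> x; apply: munits_inj; rewrite /= addrC; case: cid. Qed.

HB.instance Definition _ := GRing.isZmodule.Build (munits N)
  munits_addA munits_addC munits_add0 munits_addN.

Lemma munits_inv_uniq (x y z : N) : x + y = 0 -> x + z = 0 -> y = z.
Proof. by move=> xy xz; rewrite -[y]addr0 -xz addrA [y + x]addrC xy add0r. Qed.

End Units.

Section UnitsMap.
Variables (N N' : nmodType) (f : N -> N') (fM : nmod_morphism f).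

Lemma munits_map_subproof (x : munits N) : exists y, f (munits_val x) + y = 0.
Proof.
by have [y e] := munitsP x; exists (f y); rewrite -fM.2 e fM.1.
Qed.

Definition munits_map (x : munits N) : munits N' := MUnits (munits_map_subproof x).

End UnitsMap.

Section UnitsSheaf.
Variables (X : topologicalType) (F : nsheaf X).

Definition units_sec (U : opens X) : zmodType := munits (F U).

Definition units_res (U V : opens X) (h : V `<=` U) :
  units_sec U -> units_sec V := munits_map (nres_morph h).

Lemma units_res_morph (U V : opens X) (h : V `<=` U) :
  {morph units_res h : s t / s + t}.
Proof. by move=> s t; apply: munits_inj; rewrite /= (nres_morph h).2. Qed.

Lemma units_is_sheaf : is_sheaf units_res.
Proof.
have [idF compF sepF glueF] := nsheafP F.
split.
- by move=> U h s; apply: munits_inj; apply: idF.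
- by move=> U V W h k l s; apply: munits_inj; apply: compF.
- move=> I U V h UV s t e; apply: munits_inj; apply: (sepF _ _ _ h UV) => i.
  by have /(congr1 (@munits_val _)) := e i.
move=> I U V h UV s e.
have [i j|t et] := glueF _ _ _ h UV (fun i => munits_val (s i)).
  by have /(congr1 (@munits_val _)) := e i j.
pose s' i := sval (cid (munitsP (s i))).
have ss' i : munits_val (s i) + s' i = 0 by rewrite /s'; case: cid.
have [i j|t' et'] := glueF _ _ _ h UV s'.
  pose a : opensI (V i) (V j) `<=` V i := @subIsetl _ (V i) (V j).
  pose b : opensI (V i) (V j) `<=` V j := @subIsetr _ (V i) (V j).
  have eab : nres a (munits_val (s i)) = nres b (munits_val (s j)).
    by have /(congr1 (@munits_val _)) := e i j.
  apply: (@munits_inv_uniq _ (nres a (munits_val (s i)))).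
    by rewrite -(nres_morph a).2 ss' (nres_morph a).1.
  by rewrite eab -(nres_morph b).2 ss' (nres_morph b).1.
have tu : exists y, t + y = 0.
  exists t'; apply: (sepF _ _ _ h UV) => i.
  by rewrite (nres_morph (h i)).2 (nres_morph (h i)).1 et et' ss'.
by exists (MUnits tu) => i; apply: munits_inj; apply: et.
Qed.

Definition units_sheaf : absheaf X := AbSheaf units_res_morph units_is_sheaf.

End UnitsSheaf.

(* A presheaf on a basis enters only through the families of germs of its
   sections: [gidx] indexes these sections, the i-th one is defined on [gdom i]
   and has germ [gval x] at x. The sheaf associated to the presheaf is then the
   sheaf of families of germs that are locally of this form. *)
Record germs (X : topologicalType) (St : X -> Type) := Germs {
  gidx : Type;
  gdom : gidx -> set X;
  gval : forall i x, gdom i x -> St x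
}.

Section LocalSections.
Variables (X : topologicalType) (St : X -> Type) (L : germs St).
Implicit Types U V : opens X.

Definition is_local (U : set X) (s : forall x, U x -> St x) :=
  forall x, U x -> exists (i : gidx L) (W : set X),
  [/\ open W, W x, W `<=` gdom i &
      forall y (Uy : U y) (iy : gdom i y), W y -> s y Uy = gval iy].

Record lsec (U : set X) := LSec {
  lsec_val :> forall x, U x -> St x;
  lsecP : is_local lsec_val
}.

Lemma lsec_eq (U : set X) (s t : lsec U) : (forall x Ux, s x Ux = t x Ux) -> s = t.
Proof.
move=> e; have {}e : lsec_val s = lsec_val t.
  by apply: functional_extensionality_dep => x; apply: functional_extensionality_dep.
case: s t e => s hs [t ht] /= e; move: e hs ht => -> hs ht.
by congr LSec; apply: Prop_irrelevance.
Qed.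

Lemma lres_local (U V : set X) (h : V `<=` U) (s : lsec U) :
  is_local (fun x (Vx : V x) => s x (h x Vx)).
Proof.
move=> x /h Ux; have [i [W [oW Wx Wi e]]] := lsecP s Ux.
by exists i, W; split=> // y Vy iy Wy; apply: e.
Qed.

Definition lres (U V : set X) (h : V `<=` U) (s : lsec U) : lsec V :=
  LSec (lres_local h s).

Lemma lsec_is_sheaf :
  @is_sheaf X (fun U => lsec U) (fun U V (h : V `<=` U) => lres h).
Proof.
have irr (U : set X) (s : lsec U) x (a b : U x) : s x a = s x b.
  by congr (s x _); apply: Prop_irrelevance.
split.
- by move=> U h s; apply: lsec_eq => x Ux; exact: (irr _ s).
- by move=> U V W h k l s; apply: lsec_eq => x Ux; exact: (irr _ s).
- move=> I U V h UV s t e; apply: lsec_eq => x Ux; have [i _ Vx] := UV x Ux.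
  rewrite (irr _ s x _ (h i x Vx)) (irr _ t x _ (h i x Vx)).
  by have := congr1 (fun z => lsec_val z Vx) (e i).
move=> I U V h UV s e.
have comp i j x (Vi : V i x) (Vj : V j x) : s i x Vi = s j x Vj.
  have := congr1 (fun z => lsec_val z (conj Vi Vj)) (e i j) => /=.
  by rewrite (irr _ (s i) x _ Vi) (irr _ (s j) x _ Vj).
have cho x (Ux : U x) : {i | V i x}.
  by apply: cid; have [i _ Vi] := UV x Ux; exists i.
pose t x (Ux : U x) : St x := s (sval (cho x Ux)) x (svalP (cho x Ux)).
have tE i x Ux (Vx : V i x) : t x Ux = s i x Vx by apply: comp.
have tl : is_local t.
  move=> x Ux; have [i _ Vx] := UV x Ux.
  have [k [W [oW Wx Wk eW]]] := lsecP (s i) Vx.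
  exists k, (W `&` V i); split=> //; first exact: openI oW (osetP (V i)).
    by move=> y [Wy _]; apply: Wk.
  by move=> y Uy ky [Wy Vy]; rewrite (tE i y Uy Vy); apply: eW.
by exists (LSec tl) => i; apply: lsec_eq => x Vx /=; apply: tE.
Qed.

Lemma local0 (z : forall x, St x) (U : set X) :
    (forall x, exists2 i : gidx L, gdom i x & forall y (iy : gdom i y), z y = gval iy) ->
    (forall i : gidx L, open (gdom i)) ->
  is_local (fun x (_ : U x) => z x).
Proof.
by move=> hz oL x _; have [i ix e] := hz x; exists i, (gdom i); split=> // y _ iy _.
Qed.

Lemma local1 (f : forall x, St x -> St x) (U : set X) (s : lsec U) :
    (forall i : gidx L, exists2 k : gidx L, gdom i `<=` gdom k &
       forall x (ix : gdom i x) (kx : gdom k x), f x (gval ix) = gval kx) ->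
  is_local (fun x (Ux : U x) => f x (s x Ux)).
Proof.
move=> hf x Ux; have [i [W [oW Wx Wi e]]] := lsecP s Ux; have [k ik ek] := hf i.
exists k, W; split=> // [y /Wi/ik//|y Uy ky Wy].
by rewrite (e _ _ (Wi _ Wy)).
Qed.

Lemma local2 (f : forall x, St x -> St x -> St x) (U : set X) (s t : lsec U) :
    (forall i j : gidx L, exists2 k : gidx L, gdom i `&` gdom j `<=` gdom k &
       forall x (ix : gdom i x) (jx : gdom j x) (kx : gdom k x),
         f x (gval ix) (gval jx) = gval kx) ->
  is_local (fun x (Ux : U x) => f x (s x Ux) (t x Ux)).
Proof.
move=> hf x Ux; have [i [W [oW Wx Wi e]]] := lsecP s Ux.
have [j [W' [oW' Wx' Wj e']]] := lsecP t Ux; have [k ijk ek] := hf i j.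
exists k, (W `&` W'); split=> [|//|y [Wy W'y]|y Uy ky [Wy W'y]].
- exact: openI.
- by apply: ijk; split; [apply: Wi|apply: Wj].
by rewrite (e _ _ (Wi _ Wy)) // (e' _ _ (Wj _ W'y)).
Qed.

End LocalSections.

HB.instance Definition _ (X : topologicalType) (St : X -> Type) (L : germs St) U :=
  gen_eqMixin (lsec L U).
HB.instance Definition _ (X : topologicalType) (St : X -> Type) (L : germs St) U :=
  gen_choiceMixin (lsec L U).

Section ConstantSheaf.
Variables (X : topologicalType) (G : zmodType).

(* Sections over U are the locally constant functions U -> G. *)
Definition const_germs : germs (fun _ : X => G) :=
  @Germs X (fun _ => G) G (fun _ => setT) (fun g _ _ => g).

Definition const_sec (U : set X) := lsec const_germs U.
HB.instance Definition _ U := Choice.on (const_sec U).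

Section Group.
Variable U : set X.
Implicit Types s t : const_sec U.

Definition const_zero : const_sec U.
Proof.
refine (LSec (@local0 _ _ const_germs (fun _ => 0) U _ _)).
  by move=> x; exists 0.
by move=> g; apply: openT.
Defined.

Definition const_opp s : const_sec U.
Proof.
refine (LSec (@local1 _ _ const_germs (fun _ => -%R) U s _)).
by move=> g; exists (- g).
Defined.

Definition const_add s t : const_sec U.
Proof.
refine (LSec (@local2 _ _ const_germs (fun _ => +%R) U s t _)).
by move=> g g'; exists (g + g').
Defined.

Lemma const_addA : associative const_add.
Proof. by move=> s t u; apply: lsec_eq => x Ux; apply: addrA. Qed.
Lemma const_addC : commutative const_add.
Proof. by move=> s t; apply: lsec_eq => x Ux; apply: addrC. Qed.
Lemma const_add0 : left_id const_zero const_add.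
Proof. by move=> s; apply: lsec_eq => x Ux; apply: add0r. Qed.
Lemma const_addN : left_inverse const_zero const_opp const_add.
Proof. by move=> s; apply: lsec_eq => x Ux; apply: addNr. Qed.

HB.instance Definition _ := GRing.isZmodule.Build (const_sec U)
  const_addA const_addC const_add0 const_addN.

End Group.

Lemma const_res_morph (U V : opens X) (h : V `<=` U) :
  {morph (lres h : const_sec U -> const_sec V) : s t / s + t}.
Proof. by move=> s t; apply: lsec_eq. Qed.

Definition constant_sheaf : absheaf X :=
  @AbSheaf X (fun U => const_sec U) (fun U V h => lres h)
    const_res_morph (lsec_is_sheaf const_germs).

End ConstantSheaf.

Section BinoidStructureSheaf.
Variable M : binoidType.

(* The index (m, s) stands for the element m - s of M_s, a section over D(s);
   elements m - n s of M_s with n > 0 are covered since M_s = M_(n s). *)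
Definition bgerms : germs (@bloc M) :=
  @Germs _ (@bloc M) (M * M)%type (fun ms => bspec_D ms.2)
    (fun ms p (ps : ~ p ms.2) => bfrac ms.1 ps).

Lemma bspec_D_open (f : M) : open (bspec_D f).
Proof. by apply/bspec_openP => p pf; exists f. Qed.

Definition bsec (U : set (bspec M)) := lsec bgerms U.
HB.instance Definition _ U := Choice.on (bsec U).

Section Monoid.
Variable U : set (bspec M).
Implicit Types s t : bsec U.

Lemma bfrac_irr (p : bspec M) (m s : M) (h h' : ~ p s) : bfrac m h = bfrac m h'.
Proof. by congr bfrac; apply: Prop_irrelevance. Qed.

Definition bsec_const (m : M) : bsec U.
Proof.
refine (LSec (@local0 _ _ bgerms (fun p => bfrac m (@bprime0 M p)) U _ _)).
  move=> p; exists (m, 0); first exact: bprime0.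
  by move=> q h; apply: bfrac_irr.
by move=> ms; apply: bspec_D_open.
Defined.

Definition bsec_add s t : bsec U.
Proof.
refine (LSec (@local2 _ _ bgerms (fun p => +%R) U s t _)).
move=> [m f] [m' f']; exists (m + m', f + f') => [p [pf pf']|p pf pf' pff'].
  exact: bprimeD.
by rewrite /= bfracD; apply: bfrac_irr.
Defined.

Lemma bsec_addA : associative bsec_add.
Proof. by move=> s t u; apply: lsec_eq => x Ux; apply: addrA. Qed.
Lemma bsec_addC : commutative bsec_add.
Proof. by move=> s t; apply: lsec_eq => x Ux; apply: addrC. Qed.
Lemma bsec_add0 : left_id (bsec_const 0) bsec_add.
Proof. by move=> s; apply: lsec_eq => x Ux; apply: add0r. Qed.

HB.instance Definition _ := GRing.isNmodule.Build (bsec U)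
  bsec_addA bsec_addC bsec_add0.

Lemma bsec_addinf (s : bsec U) : s + bsec_const binf = bsec_const binf.
Proof. by apply: lsec_eq => x Ux; apply: addrbinf. Qed.

HB.instance Definition _ := Nmodule_isBinoid.Build (bsec U) bsec_addinf.

End Monoid.

Lemma bsec_res_morph (U V : opens (bspec M)) (h : V `<=` U) :
  nmod_morphism (lres h : bsec U -> bsec V).
Proof. by split=> [|s t]; apply: lsec_eq. Qed.

Definition bstruct_sheaf : nsheaf (bspec M) :=
  @NSheaf _ (fun U => bsec U) (fun U V h => lres h)
    bsec_res_morph (lsec_is_sheaf bgerms).

End BinoidStructureSheaf.

(* The multiplicative monoid of a ring, as an [nmodType]. *)
Definition mulmon (A : Type) := A.

Section MulMon.
Variable A : comPzRingType.
HB.instance Definition _ := Choice.on (mulmon A).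
HB.instance Definition _ := GRing.isNmodule.Build (mulmon A)
  (@mulrA A) (@mulrC A) (@mul1r A).
End MulMon.

Section RingStructureSheaf.
Variable A : comPzRingType.

(* The index (a, f) stands for the element a / f of A_f. *)
Definition rgerms : germs (@rloc A) :=
  @Germs _ (@rloc A) (A * A)%type (fun (ms : A * A) => [set P | ~ P ms.2])
    (fun ms P (Ps : ~ P ms.2) => rfrac ms.1 Ps).

Lemma rspec_Df_open (f : A) : open [set P : rspec A | ~ P f].
Proof. by apply/rspec_openP => P Pf; exists f. Qed.

(* The sections over U of the structure sheaf form a ring, see the instances
   below. *)
Definition rsec (U : set (rspec A)) := lsec rgerms U.
HB.instance Definition _ U := Choice.on (rsec U).

Section Ring.
Variable U : set (rspec A).
Implicit Types s t : rsec U.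

Lemma rfrac_irr (P : rspec A) (a s : A) (h h' : ~ P s) : rfrac a h = rfrac a h'.
Proof. by congr rfrac; apply: Prop_irrelevance. Qed.

Definition rsec_const (a : A) : rsec U.
Proof.
refine (LSec (@local0 _ _ rgerms (fun P => rfrac a (@rprime1 A P)) U _ _)).
  move=> P; exists (a, 1); first exact: rprime1.
  by move=> Q h; apply: rfrac_irr.
by move=> ms; apply: rspec_Df_open.
Defined.

Definition rsec_opp s : rsec U.
Proof.
refine (LSec (@local1 _ _ rgerms (fun P => -%R) U s _)).
move=> [a f]; exists (- a, f) => // P Pf Pf'.
by rewrite /= rfracN; apply: rfrac_irr.
Defined.

Definition rsec_add s t : rsec U.
Proof.
refine (LSec (@local2 _ _ rgerms (fun P => +%R) U s t _)).
move=> [a f] [b g]; exists (a * g + b * f, f * g) => [P [Pf Pg]|P Pf Pg Pfg].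
  exact: rprimeM.
by rewrite /= rfracD; apply: rfrac_irr.
Defined.

Definition rsec_mul s t : rsec U.
Proof.
refine (LSec (@local2 _ _ rgerms (fun P => *%R) U s t _)).
move=> [a f] [b g]; exists (a * b, f * g) => [P [Pf Pg]|P Pf Pg Pfg].
  exact: rprimeM.
by rewrite /= rfracM; apply: rfrac_irr.
Defined.

Lemma rsec_addA : associative rsec_add.
Proof. by move=> s t u; apply: lsec_eq => x Ux; apply: addrA. Qed.
Lemma rsec_addC : commutative rsec_add.
Proof. by move=> s t; apply: lsec_eq => x Ux; apply: addrC. Qed.
Lemma rsec_add0 : left_id (rsec_const 0) rsec_add.
Proof. by move=> s; apply: lsec_eq => x Ux; apply: add0r. Qed.
Lemma rsec_addN : left_inverse (rsec_const 0) rsec_opp rsec_add.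
Proof. by move=> s; apply: lsec_eq => x Ux; apply: addNr. Qed.

HB.instance Definition _ := GRing.isZmodule.Build (rsec U)
  rsec_addA rsec_addC rsec_add0 rsec_addN.

Lemma rsec_mulA : associative rsec_mul.
Proof. by move=> s t u; apply: lsec_eq => x Ux; apply: mulrA. Qed.
Lemma rsec_mulC : commutative rsec_mul.
Proof. by move=> s t; apply: lsec_eq => x Ux; apply: mulrC. Qed.
Lemma rsec_mul1 : left_id (rsec_const 1) rsec_mul.
Proof. by move=> s; apply: lsec_eq => x Ux; apply: mul1r. Qed.
Lemma rsec_mulD : left_distributive rsec_mul +%R.
Proof. by move=> s t u; apply: lsec_eq => x Ux; apply: mulrDl. Qed.

HB.instance Definition _ := GRing.Zmodule_isComPzRing.Build (rsec U)
  rsec_mulA rsec_mulC rsec_mul1 rsec_mulD.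

End Ring.

Lemma rsec_res_morph (U V : opens (rspec A)) (h : V `<=` U) :
  nmod_morphism (lres h : mulmon (rsec U) -> mulmon (rsec V)).
Proof. by split=> [|s t]; apply: lsec_eq. Qed.

(* The structure sheaf with its multiplication only; the addition is irrelevant
   for the sheaf of units. *)
Definition rstruct_sheaf_mul : nsheaf (rspec A) :=
  @NSheaf _ (fun U => mulmon (rsec U)) (fun U V h => lres h)
    rsec_res_morph (lsec_is_sheaf rgerms).

End RingStructureSheaf.

Section BinoidAlgebra.
Variables (K : fieldType) (M : binoidType).

(* K[M] is zero when 0 = binf in M, hence it is only a [comPzRingType]. *)
Definition binoid_pt := {mu : M | mu != binf}.

Definition binalg := {malg K[binoid_pt]}.
HB.instance Definition _ := GRing.Lmodule.on binalg.

(* T^mu, with T^binf = 0. *)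
Definition binT (mu : M) : binalg :=
  if insub mu is Some nu then << (nu : binoid_pt) >> else 0.

Definition binalg_mul (f g : binalg) : binalg :=
  \sum_(mu <- msupp f) \sum_(nu <- msupp g)
     (f@_mu * g@_nu) *: binT (val mu + val nu).

Lemma binT_inf : binT binf = 0.
Proof. by rewrite /binT insubF ?eqxx. Qed.

Lemma binT_val (mu : binoid_pt) : binT (val mu) = << mu >>.
Proof. by rewrite /binT valK. Qed.

Lemma binalgE (f : binalg) : f = \sum_(mu <- msupp f) f@_mu *: binT (val mu).
Proof.
rewrite {1}[f]monalgE; apply: eq_bigr => mu _.
by rewrite binT_val malgZ_def; apply/malgP => nu; rewrite mcoeffU fgscaleE mcoeffU mulrnAr mulr1.
Qed.

(* The linear map sending T^mu to h mu, for h binf = 0. *)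
Definition bin_ext (V : lmodType K) (h : M -> V) (f : binalg) : V :=
  \sum_(mu <- msupp f) f@_mu *: h (val mu).

Lemma bin_extW (V : lmodType K) (h : M -> V) (f : binalg) (d : {fset binoid_pt}) :
  {subset msupp f <= d} -> bin_ext h f = \sum_(mu <- d) f@_mu *: h (val mu).
Proof.
move=> fd; apply: big_fset_incl; first exact/fsubsetP.
by move=> mu _ /mcoeff_outdom ->; rewrite scale0r.
Qed.

Lemma bin_ext_linear (V : lmodType K) (h : M -> V) : linear (bin_ext h).
Proof.
move=> c f g; pose d := (msupp f `|` msupp g `|` msupp (c *: f + g))%fset.
have df : {subset msupp f <= d} by move=> mu; rewrite !inE => ->.
have dg : {subset msupp g <= d} by move=> mu; rewrite !inE => ->; rewrite orbT.
have dh : {subset msupp (c *: f + g) <= d}.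
  by move=> mu; rewrite !inE => ->; rewrite orbT.
rewrite (bin_extW _ df) (bin_extW _ dg) (bin_extW _ dh).
rewrite scaler_sumr -big_split; apply: eq_bigr => mu _ /=.
by rewrite mcoeffD mcoeffZ scalerDl scalerA.
Qed.

HB.instance Definition _ (V : lmodType K) (h : M -> V) :=
  GRing.isLinear.Build K binalg V _ (bin_ext h) (bin_ext_linear h).

Lemma bin_ext_sum (V : lmodType K) (h : M -> V) (I : Type) (r : seq I)
    (F : I -> binalg) :
  bin_ext h (\sum_(i <- r) F i) = \sum_(i <- r) bin_ext h (F i).
Proof. exact: linear_sum. Qed.

Lemma bin_extZ (V : lmodType K) (h : M -> V) (c : K) (f : binalg) :
  bin_ext h (c *: f) = c *: bin_ext h f.
Proof. exact: linearZ. Qed.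

Lemma bin_extU (V : lmodType K) (h : M -> V) (nu : binoid_pt) :
  bin_ext h << nu >> = h (val nu).
Proof.
rewrite (@bin_extW _ _ _ [fset nu]%fset); last first.
  by move=> x; rewrite !inE -mcoeff_neq0 mcoeffU [nu == x]eq_sym; case: (x == nu); rewrite ?eqxx.
by rewrite big_seq_fset1 mcoeffU eqxx scale1r.
Qed.

Lemma bin_extT (V : lmodType K) (h : M -> V) (mu : M) :
  h binf = 0 -> bin_ext h (binT mu) = h mu.
Proof.
move=> h0; rewrite /binT; case: insubP => [nu _ <-|/negPn/eqP ->].
  exact: bin_extU.
by rewrite h0 linear0.
Qed.

Lemma binalg_mulE f g : binalg_mul f g =
  bin_ext (fun mu => bin_ext (fun nu => binT (mu + nu)) g) f.
Proof.
apply: eq_bigr => mu _; rewrite scaler_sumr.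
by apply: eq_bigr => nu _; rewrite scalerA.
Qed.

Lemma bin_inf_ext (g : binalg) : bin_ext (fun nu => binT (binf + nu)) g = 0.
Proof.
by rewrite /bin_ext big1 // => nu _; rewrite addrC addrbinf binT_inf scaler0.
Qed.

Lemma binalg_mulC : commutative binalg_mul.
Proof.
move=> f g; rewrite /binalg_mul exchange_big; apply: eq_bigr => nu _.
by apply: eq_bigr => mu _; rewrite mulrC addrC.
Qed.

Lemma binalg_mulA : associative binalg_mul.
Proof.
move=> f g h; rewrite (binalg_mulE (binalg_mul f g)) (binalg_mulE f (binalg_mul g h)).
rewrite [binalg_mul f g]/binalg_mul bin_ext_sum; apply: eq_bigr => mu _.
rewrite [binalg_mul g h]/binalg_mul !bin_ext_sum scaler_sumr; apply: eq_bigr => nu _.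
rewrite bin_ext_sum [RHS]bin_extZ bin_extT ?bin_inf_ext // !scaler_sumr.
apply: eq_bigr => rho _; rewrite bin_extZ bin_extT; last first.
  by rewrite addrbinf binT_inf.
by rewrite !scalerA mulrA addrA.
Qed.

Lemma binalg_mul1 : left_id (binT 0) binalg_mul.
Proof.
move=> f; rewrite binalg_mulE bin_extT ?bin_inf_ext // [RHS]binalgE.
by apply: eq_bigr => nu _; rewrite add0r.
Qed.

Lemma binalg_mulD : left_distributive binalg_mul +%R.
Proof. by move=> f g h; rewrite !binalg_mulE linearD. Qed.

HB.instance Definition _ := GRing.Zmodule_isComPzRing.Build binalg
  binalg_mulA binalg_mulC binalg_mul1 binalg_mulD.

Lemma binalg_scaleAl (c : K) (f g : binalg) : c *: (f * g) = (c *: f) * g.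
Proof. by rewrite /GRing.mul /= !binalg_mulE linearZ. Qed.

Lemma binalg_scaleAr (c : K) (f g : binalg) : c *: (f * g) = f * (c *: g).
Proof. by rewrite mulrC binalg_scaleAl mulrC. Qed.

Lemma binT0 : binT 0 = 1. Proof. by []. Qed.

Lemma binTM (mu nu : M) : binT mu * binT nu = binT (mu + nu).
Proof.
rewrite [LHS]binalg_mulE bin_extT ?bin_inf_ext // bin_extT //.
by rewrite addrbinf binT_inf.
Qed.

End BinoidAlgebra.

Section CombinatorialIdeals.
Variables (K : fieldType) (M : binoidType).
Implicit Types (I : set M) (f g : binalg K M).

(* K[I], the linear span of the T^mu with mu in I. *)
Definition bin_ideal I : set (binalg K M) :=
  [set f | exists (s : seq M) (c : M -> K),
     (forall mu, mu \in s -> I mu) /\ f = \sum_(mu <- s) c mu *: binT K mu].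

Lemma binT_coeff (mu : M) (nu : binoid_pt M) :
  (binT K mu)@_nu = (mu == val nu)%:R.
Proof.
rewrite /binT; case: insubP => [rho _ <-|/negPn/eqP ->].
  by rewrite mcoeffU.
by rewrite mcoeff0 eq_sym (negbTE (valP nu)).
Qed.

Lemma binalg_coeff_sum (J : Type) (r : seq J) (Q : pred J)
    (F : J -> binalg K M) nu :
  (\sum_(j <- r | Q j) F j)@_nu = \sum_(j <- r | Q j) (F j)@_nu.
Proof. exact: raddf_sum. Qed.

Lemma binalgM_coeff f g (rho : binoid_pt M) :
  (f * g)@_rho = \sum_(mu <- msupp f) \sum_(nu <- msupp g)
    f@_mu * g@_nu * (val mu + val nu == val rho)%:R.
Proof.
rewrite [LHS]binalg_coeff_sum; apply: eq_bigr => mu _.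
rewrite binalg_coeff_sum; apply: eq_bigr => nu _.
by rewrite mcoeffZ binT_coeff.
Qed.

Lemma bin_idealP I f :
  bin_ideal I f <-> forall nu, f@_nu != 0 -> I (val nu).
Proof.
split=> [[s [c [sI ->]]] nu|fI].
  move=> h; apply: contrapT => nI; move/eqP: h; apply; rewrite binalg_coeff_sum big_seq big1 // => mu /sI Imu.
  rewrite mcoeffZ binT_coeff; case: eqP => [e|]; last by rewrite mulr0.
  by rewrite -e in nI.
exists [seq val nu | nu <- msupp f].
exists (fun mu => if insub mu is Some nu then f@_nu else 0); split.
  by move=> _ /mapP[nu nuf ->]; apply: fI; rewrite mcoeff_neq0.
by rewrite big_map [LHS]binalgE; apply: eq_bigr => nu _; rewrite valK.
Qed.

Lemma bin_ideal0 I : bin_ideal I 0.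
Proof. by apply/bin_idealP => nu; rewrite mcoeff0 eqxx. Qed.

Lemma bin_idealD I f g : bin_ideal I f -> bin_ideal I g -> bin_ideal I (f + g).
Proof.
move=> /bin_idealP fI /bin_idealP gI; apply/bin_idealP => nu; rewrite mcoeffD => h.
have [f0|/fI//] := eqVneq (f@_nu) 0.
by apply: gI; move: h; rewrite f0 add0r.
Qed.

Lemma bin_idealZ I c f : bin_ideal I f -> bin_ideal I (c *: f).
Proof.
move=> /bin_idealP fI; apply/bin_idealP => nu; rewrite mcoeffZ => h.
by apply: fI; move: h; rewrite mulf_eq0 negb_or => /andP[].
Qed.

Lemma bin_ideal_sum I (J : eqType) (r : seq J) (F : J -> binalg K M) :
  (forall j, j \in r -> bin_ideal I (F j)) -> bin_ideal I (\sum_(j <- r) F j).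
Proof.
move=> h; rewrite big_seq; elim/big_ind: _ => //; first exact: bin_ideal0.
exact: bin_idealD.
Qed.

Lemma bin_idealT I mu : I mu -> bin_ideal I (binT K mu).
Proof.
move=> Imu; apply/bin_idealP => nu; rewrite binT_coeff.
by case: (mu =P val nu) => [<-|]; rewrite ?eqxx.
Qed.

Lemma bin_ideal_ideal I : binoid_ideal I -> ring_ideal (bin_ideal I).
Proof.
move=> [_ ID]; split; [exact: bin_ideal0|exact: bin_idealD|].
move=> f g /bin_idealP gI; apply: bin_ideal_sum => mu _; apply: bin_ideal_sum => nu nug.
by apply: bin_idealZ; apply: bin_idealT; apply: ID; apply: gI; rewrite mcoeff_neq0.
Qed.

Lemma bin_idealDP I (P : rspec (binalg K M)) :
  rspec_D (bin_ideal I) P <-> exists2 mu, I mu & ~ P (binT K mu).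
Proof.
split=> [/rspec_DP[f [s [c [sI ->]]]]|[mu Imu Pmu]]; last first.
  by apply/rspec_DP; exists (binT K mu) => //; apply: bin_idealT.
apply: contra_notP => h; have [[P0 PD PM] _ _] := rspecP P.
rewrite big_seq; elim/big_ind: _ => // mu /sI Imu.
have Pmu : P (binT K mu) by apply: contrapT => Pmu; apply: h; exists mu.
by rewrite -[binT K mu]mul1r binalg_scaleAl; apply: PM.
Qed.

End CombinatorialIdeals.

Arguments bin_ideal K {M} I.

(* An alias of [rspec (binalg K M)] with its own topology: combinatorial instead
   of Zariski. *)
Definition cspec (K : fieldType) (M : binoidType) := rspec (binalg K M).

Section CombinatorialTopology.
Variables (K : fieldType) (M : binoidType).

HB.instance Definition _ := Choice.on (cspec K M).

Definition cspec_open (U : set (cspec K M)) :=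
  exists2 I : set M, binoid_ideal I & U = rspec_D (bin_ideal K I).

Lemma cspec_openP U : cspec_open U <-> forall P : cspec K M, U P ->
  exists2 mu, ~ P (binT K mu) & forall Q : cspec K M, ~ Q (binT K mu) -> U Q.
Proof.
split=> [[I _ ->] P /bin_idealDP[mu Imu Pmu]|hU].
  by exists mu => // Q Qmu; apply/bin_idealDP; exists mu.
exists [set mu | forall Q : cspec K M, ~ Q (binT K mu) -> U Q]; last first.
  apply/seteqP; split=> [P /hU[mu Pmu muU]|P /bin_idealDP[mu muU Pmu]].
    by apply/bin_idealDP; exists mu.
  exact: muU.
split=> [Q []|nu mu muU Q]; first by rewrite binT_inf; apply: rprime0.
by rewrite -binTM => /rprimeMr; apply: muU.
Qed.

Lemma cspec_openT : cspec_open setT.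
Proof. by apply/cspec_openP => P _; exists 0 => //; rewrite binT0; apply: rprime1. Qed.

Lemma cspec_openI : setI_closed cspec_open.
Proof.
move=> U V /cspec_openP hU /cspec_openP hV; apply/cspec_openP => P [UP VP].
have [a Pa aU] := hU P UP; have [b Pb bV] := hV P VP.
exists (a + b); rewrite -binTM; first exact: rprimeM.
by move=> Q Qab; split; [apply/aU/(rprimeMl Qab)|apply/bV/(rprimeMr Qab)].
Qed.

Lemma cspec_open_bigU (J : Type) (U : J -> set (cspec K M)) :
  (forall i, cspec_open (U i)) -> cspec_open (\bigcup_i U i).
Proof.
move=> hU; apply/cspec_openP => P [i _ UP].
have /cspec_openP/(_ P UP)[a Pa aU] := hU i.
by exists a => // Q /aU UQ; exists i.
Qed.

HB.instance Definition _ := isOpenTopological.Build (cspec K M)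
  cspec_openT cspec_openI cspec_open_bigU.

Definition to_cspec (P : rspec (binalg K M)) : cspec K M := P.

Lemma to_cspec_continuous : continuous to_cspec.
Proof.
apply/continuousP => U /cspec_openP hU; apply/rspec_openP => P /hU[mu Pmu muU].
by exists (binT K mu).
Qed.

(* (comb F)(U) = F(U) for combinatorial open U: restricting a Zariski sheaf to the
   combinatorial open sets is pushing it forward along the identity. *)
Definition comb (F : absheaf (rspec (binalg K M))) : absheaf (cspec K M) :=
  pushforward to_cspec_continuous F.

End CombinatorialTopology.

(* The proof that K[p] is prime exhibits, for f and g outside K[p], a product of
   monomials outside p that cannot cancel in f * g: the product of the largest
   monomials for a translation invariant order comparing the finitely many
   monomials involved. *)

Section Primality.
Variables (K : fieldType) (M : binoidType).
Hypothesis can : binoid_cancellative M.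
Hypothesis tf : binoid_torsion_free M.
Variable p : bspec M.
Implicit Types (R : M -> M -> Prop) (x y u v w : M).

Lemma nbinf x : ~ p x -> x <> binf.
Proof. by move=> px e; apply: px; rewrite e; apply: bprime_inf. Qed.

Lemma cancelp a x y : ~ p (a + x) -> a + x = a + y -> x = y.
Proof. by move=> /nbinf; move=> h e; apply: can e h. Qed.

Lemma bprimeMn x n : ~ p x -> ~ p (x *+ n).
Proof.
move=> px; elim: n => [|n IH]; first exact: bprime0.
by rewrite mulrS; apply: bprimeD.
Qed.

Arguments bprimeMn {x} n _ _.

Lemma torsionp n x y : (0 < n)%N -> ~ p x -> x *+ n = y *+ n -> x = y.
Proof. by move=> n0 px e; apply: (tf n0 e); apply/nbinf/bprimeMn. Qed.

Record good R : Prop := Good {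
  good_dom : forall x y, R x y -> ~ p x /\ ~ p y;
  good_irr : forall x, ~ R x x;
  good_trans : forall y x z, R x y -> R y z -> R x z;
  good_add : forall a x y, ~ p a -> R x y -> R (a + x) (a + y);
  good_can : forall a x y, R (a + x) (a + y) -> R x y;
  good_div : forall n x y, (0 < n)%N -> R (x *+ n) (y *+ n) -> R x y
}.

Section Extension.
Variable R : M -> M -> Prop.
Hypothesis gR : good R.
Let Re x y := R x y \/ x = y.

Lemma re_trans y x z : Re x y -> Re y z -> Re x z.
Proof.
move=> [xy|->] // [yz|<-]; by [left; apply: good_trans gR _ _ _ xy yz|left].
Qed.

Lemma re_add a x y : ~ p a -> Re x y -> Re (a + x) (a + y).
Proof. by move=> pa [xy|->]; [left; apply: good_add|right]. Qed.

Lemma re_comb a b c d e f g : ~ p d -> ~ p e ->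
  Re (a + b) (c + d) -> Re (c + e) (f + g) -> Re (a + (b + e)) (f + (d + g)).
Proof.
move=> pd pe /(re_add pe) h /(re_add pd) h'.
rewrite addrA addrC [X in Re _ X]addrCA; apply: re_trans h' => //.
by rewrite [d + (c + e)]addrCA [d + e]addrC [c + _]addrCA.
Qed.

Lemma re_can a x y : ~ p (a + x) -> Re (a + x) (a + y) -> Re x y.
Proof. by move=> pa [/good_can xy|/(cancelp pa)]; [left; apply: xy|right]. Qed.

Lemma re_div n x y : (0 < n)%N -> ~ p x -> Re (x *+ n) (y *+ n) -> Re x y.
Proof. by move=> n0 px [/good_div xy|/torsionp]; [left; apply: xy|right; auto]. Qed.

Lemma re_mul n x y : ~ p x -> ~ p y -> Re x y -> Re (x *+ n) (y *+ n).
Proof.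
move=> px py xy; elim: n => [|n IH]; first by right.
rewrite !mulrS; apply: (@re_trans (x + y *+ n)); first exact: re_add.
by rewrite ![_ + y *+ n]addrC; apply: re_add => //; apply: bprimeMn.
Qed.

Arguments re_mul n {x y} _ _ _.

Variables x0 y0 : M.
Hypotheses (px : ~ p x0) (py : ~ p y0).
Hypotheses (nxy : ~ R y0 x0) (xy0 : x0 <> y0).

Definition ext_rel u v := [/\ ~ p u, ~ p v, u <> v &
  exists k n, (0 < k)%N /\ Re (u *+ k + y0 *+ n) (v *+ k + x0 *+ n)].

Lemma ext_sub u v : R u v -> ext_rel u v.
Proof.
move=> uv; have [pu pv] := good_dom gR uv; split=> //.
  by move=> e; move: uv; rewrite e; apply: good_irr.
by exists 1%N, 0%N; split=> //; rewrite !addr0; left.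
Qed.

Lemma ext_xy : ext_rel x0 y0.
Proof. by split=> //; exists 1%N, 1%N; split=> //; right; rewrite addrC. Qed.

Lemma ext_good : good ext_rel.
Proof.
split.
- by move=> u v [].
- by move=> u [].
- move=> v u w [pu pv uv [k [n [k0 h]]]] [_ pw vw [k' [n' [k'0 h']]]].
  have H : Re (u *+ (k * k') + y0 *+ (n * k' + n' * k))
              (w *+ (k * k') + x0 *+ (n * k' + n' * k)).
    have {}h := re_mul k' (bprimeD (bprimeMn k pu) (bprimeMn n py))
      (bprimeD (bprimeMn k pv) (bprimeMn n px)) h.
    have {}h' := re_mul k (bprimeD (bprimeMn k' pv) (bprimeMn n' py))
      (bprimeD (bprimeMn k' pw) (bprimeMn n' px)) h'.
    move: h h'; rewrite !mulrnDl -!mulrnA !mulrnDr [(k' * k)%N]mulnC; apply: re_comb; exact: bprimeMn.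
  split=> //; last first.
    by exists (k * k')%N, (n * k' + n' * k)%N; rewrite muln_gt0 k0 k'0.
  move=> e; move: H; rewrite -e => /re_can H.
  have {}H : Re (y0 *+ (n * k' + n' * k)) (x0 *+ (n * k' + n' * k)).
    by apply: H; apply: bprimeD; apply: bprimeMn.
  have [N0|] := posnP (n * k' + n' * k); last first.
    by move=> N0; case: (re_div N0 py H) => // e'; apply: xy0.
  have n0 : n = 0%N by move: N0 k'0; case: (n) (k') => [|?] [|?].
  have n'0 : n' = 0%N.
    by move: N0 k0; rewrite n0 mul0n add0n; case: (n') (k) => [|?] [|?].
  move: h h'; rewrite n0 n'0 !mulr0n !addr0 -e => h h'.
  have [ruv|//] := re_div k0 pu h; have [rvu|/esym//] := re_div k'0 pv h'.
  exact: (good_irr gR) (good_trans gR ruv rvu).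
- move=> a u v pa [pu pv uv [k [n [k0 h]]]]; split; [exact: bprimeD..| |].
    by move=> e; apply: uv; apply: (@cancelp a) => //; apply: bprimeD.
  exists k, n; split=> //; rewrite !mulrnDl -!addrA.
  by apply: re_add => //; apply: bprimeMn.
- move=> a u v [pau pav uv [k [n [k0 h]]]].
  split; [exact: bprimeDr pau|exact: bprimeDr pav|by move=> e; apply: uv; rewrite e|].
  exists k, n; split=> //; move: h; rewrite !mulrnDl -!addrA; apply: re_can.
  by apply: bprimeD; [|apply: bprimeD]; apply: bprimeMn;
    [exact: bprimeDl pau|exact: bprimeDr pau|].
move=> m u v m0 [pu pv uv [k [n [k0 h]]]].
have pd w : ~ p (w *+ m) -> ~ p w by case: m m0 {pu pv uv h} => // m _; rewrite mulrS => /bprimeDl.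
split; [exact: pd|exact: pd|by move=> e; apply: uv; rewrite e|].
by exists (m * k)%N, n; rewrite muln_gt0 m0 k0 !mulrnA.
Qed.

End Extension.

Definition compared R (xy : M * M) := [\/ R xy.1 xy.2, R xy.2 xy.1 | xy.1 = xy.2].

Lemma good_total (l : seq (M * M)) :
  (forall xy, xy \in l -> ~ p xy.1 /\ ~ p xy.2) ->
  exists2 R, good R & forall xy, xy \in l -> compared R xy.
Proof.
elim: l => [|[x y] l IH] hl.
  by exists (fun _ _ => False); [split=> // x []|move=> xy; rewrite in_nil].
have [xy h|R gR hR] := IH; first by apply: hl; rewrite inE h orbT.
have [px py] := hl (x, y) (mem_head _ _).
have [c|c] := pselect (compared R (x, y)).
  by exists R => // xy; rewrite inE => /predU1P[->|/hR].
have ryx : ~ R y x by move=> h; apply: c; apply: Or32.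
have nxy : x <> y by move=> h; apply: c; apply: Or33.
exists (ext_rel R x y); first exact: ext_good.
move=> xy; rewrite inE => /predU1P[->|/hR].
  by apply: Or31; apply: ext_xy.
by case=> h; [apply: Or31|apply: Or32|apply: Or33] => //; apply: ext_sub.
Qed.

Lemma good_max R (s : seq M) : good R -> s != [::] ->
  (forall x y, x \in s -> y \in s -> compared R (x, y)) ->
  exists2 a, a \in s & forall x, x \in s -> R x a \/ x = a.
Proof.
move=> gR; elim: s => // x s IH _ hs.
have [->|s0] := eqVneq s [::].
  by exists x; rewrite ?mem_head // => y; rewrite inE => /eqP ->; right.
have [//|u v us vs|a as_ ha] := IH.
  by apply: hs; rewrite inE ?us ?vs orbT.
have [xa|ax|/= xa] := hs x a (mem_head _ _) (mem_behead (s := x :: s) as_).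
- exists a; first by rewrite inE as_ orbT.
  by move=> y; rewrite inE => /predU1P[->|/ha//]; left.
- exists x; first exact: mem_head.
  move=> y; rewrite inE => /predU1P[->|/ha[ya|->]]; [by right| |by left].
  by left; apply: good_trans gR _ _ _ ya ax.
exists a; first by rewrite inE as_ orbT.
by move=> y; rewrite inE => /predU1P[->|/ha//]; right.
Qed.

Lemma bin_ideal_prime : ring_prime (bin_ideal K p).
Proof.
have [pI pT _] := bspecP p; split; first exact: bin_ideal_ideal.
  move=> h; have : bin_ideal K p (binT K 0) by rewrite h.
  move=> /bin_idealP hp; apply: (@bprime0 M p).
  have n0 : (0 : M) != binf by apply/eqP; apply: nbinf; apply: bprime0.
  by apply: (hp (exist _ 0 n0)); rewrite binT_coeff eqxx oner_eq0.
move=> f g fg; apply: contrapT => /not_orP[nf ng].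
pose sp (h : binalg K M) := [seq mu <- [seq val nu | nu <- msupp h] | `[< ~ p mu >]].
have spP h nu : h@_nu != 0 -> ~ p (val nu) -> val nu \in sp h.
  move=> hn pn; rewrite mem_filter; apply/andP; split; first exact/asboolP.
  by apply/mapP; exists nu => //; rewrite -mcoeff_neq0.
have sp0 h : ~ bin_ideal K p h -> sp h != [::].
  move=> nh; apply/negP => /eqP e; apply: nh; apply/bin_idealP => nu hn.
  by apply: contrapT => /(spP _ _ hn); rewrite e.
have spp h mu : mu \in sp h -> ~ p mu.
  by rewrite mem_filter => /andP[/asboolP].
have spE h mu : mu \in sp h -> exists2 nu : binoid_pt M, h@_nu != 0 & mu = val nu.
  rewrite mem_filter => /andP[_ /mapP[nu nuh ->]]; exists nu => //.
  by rewrite mcoeff_neq0.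
pose l := [seq (x, y) | x <- sp f, y <- sp f] ++ [seq (x, y) | x <- sp g, y <- sp g].
have [xy|R gR hR] := @good_total l.
  by rewrite mem_cat => /orP[] /allpairsP[[x y] /= [/spp ? /spp ? ->]].
have [x y xf yf|a af ha] := good_max gR (sp0 _ nf).
  by apply: hR; rewrite mem_cat allpairs_f.
have [x y xg yg|b bg hb] := good_max gR (sp0 _ ng).
  by apply: hR; rewrite mem_cat [X in _ || X]allpairs_f ?orbT.
have [pa pb] := (spp _ _ af, spp _ _ bg).
have [a' fa' ea] := spE _ _ af; have [b' gb' eb] := spE _ _ bg.
have nab : a + b != binf by apply/eqP; apply: nbinf; apply: bprimeD.
have uniq_ab mu nu : f@_mu != 0 -> g@_nu != 0 -> val mu + val nu = a + b ->
    mu = a' /\ nu = b'.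
  move=> fmu gnu e; have pmn : ~ p (val mu + val nu) by rewrite e; apply: bprimeD.
  have pm := bprimeDl pmn; have pn := bprimeDr pmn.
  have [ma|ma] := ha _ (spP _ _ fmu pm); have [nb|nb] := hb _ (spP _ _ gnu pn).
  - case: (good_irr gR (x := a + b)); rewrite -{1}e.
    apply: (good_trans gR (y := val mu + b)); first exact: good_add.
    by rewrite ![_ + b]addrC; apply: good_add.
  - case: (good_irr gR (x := a + b)); rewrite -{1}e nb.
    by rewrite ![_ + b]addrC; apply: good_add.
  - case: (good_irr gR (x := a + b)); rewrite -{1}e ma; exact: good_add.
  by split; apply: val_inj; rewrite ?ma ?nb.
move: fg => /bin_idealP /(_ (exist _ (a + b) nab)).
suff -> : (f * g)@_(exist _ (a + b) nab) = f@_a' * g@_b'.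
  by rewrite mulf_neq0 // => /(_ isT) /=; apply: bprimeD.
rewrite binalgM_coeff (big_fsetD1 a') -?mcoeff_neq0 //=.
rewrite (big_fsetD1 b') -?mcoeff_neq0 //= -ea -eb eqxx mulr1.
rewrite big_seq big1 ?addr0 => [|nu]; last first.
  rewrite !inE -mcoeff_neq0 => /andP[nb gnu].
  case: eqP => [e|]; last by rewrite mulr0.
  rewrite ea in e; have := uniq_ab a' nu fa' gnu; rewrite ea => /(_ e)[_ enu].
  by rewrite enu eqxx in nb.
rewrite big_seq big1 ?addr0 // => mu.
rewrite !inE -mcoeff_neq0 => /andP[na fmu]; rewrite big_seq big1 // => nu.
rewrite -mcoeff_neq0 => gnu; case: eqP => [e|]; last by rewrite mulr0.
have [ema _] := uniq_ab _ _ fmu gnu e.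
by rewrite ema eqxx in na.
Qed.

End Primality.

Section SpecMap.
Variables (K : fieldType) (M : binoidType).
Hypothesis can : binoid_cancellative M.
Hypothesis tf : binoid_torsion_free M.

(* i : Spec M -> Spec K[M], p |-> K[p]. *)
Definition spec_map (p : bspec M) : rspec (binalg K M) :=
  RSpec (bin_ideal_prime K can tf p).

Lemma spec_map_continuous : continuous spec_map.
Proof.
apply/continuousP => U /rspec_openP hU; apply/bspec_openP => p /hU[f pf fU].
have [nu fnu pnu] : exists2 nu, f@_nu != 0 & ~ p (val nu).
  apply: contrapT => h; apply: pf; apply/bin_idealP => nu fnu.
  by apply: contrapT => pnu; apply: h; exists nu.
exists (val nu) => // q qnu; apply: fU => /bin_idealP /(_ nu fnu); exact: qnu.
Qed.

End SpecMap.

Arguments spec_map K {M} can tf p.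
Arguments spec_map_continuous K {M} can tf.

(* Main.v *)
(** Send a prime [P] of [K[M]] to its contraction [{mu | T^mu in P}]; a
   combinatorial open set contains [P] iff it contains [K[p]], [p] the contraction
   of [P]. A unit [m - n] of [M_p] and a constant [c] then give the unit
   [c T^m / T^n] at [P], which defines a morphism from the right hand side to the
   left hand side. It is injective because an equality of such fractions at [K[q]]
   can be read off coefficients of monomials outside [q].

   For surjectivity, let [f] be a unit over a combinatorial open set and [p] a point
   of [Spec M] in it. As [M] is finitely generated, [p] has a smallest neighbourhood
   [D(mu)], consisting of the primes contained in [p]. Since [K[M]] is reduced, [f]
   is [a / T^(n mu)] on [D(T^mu)], its inverse is of the same form, and [a]
   divides a monomial that lies outside [p]. Modulo each [K[q]] with [q <= p]
   this forces [a] to be a single monomial, because a translation invariant order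
   on monomials makes the largest and the smallest terms of a product survive; the
   monomial lies outside [p], so it is the same for all [q]. Hence
   [f = c T^m / T^(n mu)] on [D(T^mu)], and these local forms glue by injectivity. *)

Require Import Defs.
From mathcomp Require Import all_boot all_order all_algebra.
From mathcomp Require Import boolp classical_sets topology.
From mathcomp Require Import finmap monalg ring.

Set Implicit Arguments.
Unset Strict Implicit.
Unset Printing Implicit Defensive.

Import GRing.Theory.

Local Open Scope ring_scope.
Local Open Scope classical_set_scope.

(** * Prime avoidance and sections over basic open sets *)

Section PrimeAvoidance.
Variable A : comPzRingType.
Implicit Types (I J : set A) (t x y : A).

Definition ideal_add_elt I x : set A :=
  [set z | exists a b, I a /\ z = a + b * x].

Lemma ideal_add_elt_ideal I x : ring_ideal I -> ring_ideal (ideal_add_elt I x).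
Proof.
move=> [I0 ID IM]; split.
- by exists 0, 0; rewrite mul0r addr0.
- move=> _ _ [a [b [Ia ->]]] [a' [b' [Ia' ->]]]; exists (a + a'), (b + b').
  by split; [exact: ID|ring].
move=> c _ [a [b [Ia ->]]]; exists (c * a), (c * b).
by split; [exact: IM|ring].
Qed.

(** An ideal maximal among those containing [I] and no power of [t] is prime: adjoining any further
    element reaches a power of [t], and if the product of two such elements were in the ideal, so
    would be a product of two such powers. *)
Lemma rprime_avoid I t : ring_ideal I -> (forall n, ~ I (t ^+ n)) ->
  exists2 P : rspec A, I `<=` P & ~ P t.
Proof.
move=> idI It.
pose good J := [/\ ring_ideal J, I `<=` J & forall n, ~ J (t ^+ n)].
have [F Fg Ftot|J [Jg Jmax]] := @Zorn_bigcup A [set J | J = set0 \/ good J].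
  have [->|] := eqVneq (\bigcup_(X in F) X) set0; first by left.
  case/set0P=> x0 [X0 FX0 X0x0]; right.
  have gX X x : F X -> X x -> good X by move=> /Fg[->|].
  have [[X00 _ _] IX0 _] := gX _ _ FX0 X0x0.
  split=> [|y /IX0 X0y|n [X FX Xt]]; last 2 first.
  - by exists X0.
  - by have [_ _ /(_ n)] := gX _ _ FX Xt.
  split=> [|a b [X FX Xa] [Y FY Yb]|a b [X FX Xb]]; first by exists X0.
    have [XY|YX] := Ftot _ _ FX FY.
      exists Y => //; have [[_ D _] _ _] := gX _ _ FY Yb; apply: D => //.
      exact: XY.
    exists X => //; have [[_ D _] _ _] := gX _ _ FX Xa; apply: D => //.
    exact: YX.
  by exists X => //; have [[_ _ D] _ _] := gX _ _ FX Xb; apply: D.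
have {Jg} [[J0 JD JM] IJ Jt] : good J.
  case: Jg => // J0; case: (Jmax I); last by right; split.
  by rewrite J0; split=> [y []|/(_ 0)]; case: idI => I0 _ _ // /(_ I0).
have big x : ~ J x -> exists n a b, J a /\ t ^+ n = a + b * x.
  move=> Jx; apply: contrapT => h; apply: (Jmax (ideal_add_elt J x)).
    split=> [y Jy|/(_ x) hx]; first by exists y, 0; rewrite mul0r addr0.
    by apply/Jx/hx; exists 0, 1; rewrite mul1r add0r.
  right; split; first exact: ideal_add_elt_ideal.
    by move=> y /IJ Jy; exists y, 0; rewrite mul0r addr0.
  by move=> n [a [b ?]]; apply: h; exists n, a, b.
have Jp : ring_prime J.
  split=> [//||x y Jxy]; first by move=> JT; apply: (Jt 0%N); rewrite JT.
  apply: contrapT => /not_orP[/big[n [a [b [Ja en]]]] /big[m [c [d [Jc em]]]]].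
  apply: (Jt (n + m)%N); rewrite exprD en em.
  have -> : (a + b * x) * (c + d * y) =
      (c + d * y) * a + (b * x * c + b * d * (x * y)) by ring.
  by apply: (JD); [exact: JM|apply: JD; exact: JM].
by exists (RSpec Jp) => //; apply: (Jt 1%N).
Qed.

Lemma rprimeX (P : rspec A) x n : P (x ^+ n) -> P x.
Proof.
have [_ _ Pp] := rspecP P.
elim: n => [|n IH]; first by rewrite expr0 => /rprime1.
by rewrite exprS => /Pp[].
Qed.

Definition ring_reduced := forall x n, x ^+ n = 0 -> x = 0 :> A.

Lemma eq0_of_primes x : ring_reduced -> (forall P : rspec A, P x) -> x = 0.
Proof.
move=> red Px; apply: contrapT => x0.
have [||P _ []//] := @rprime_avoid [set 0] x.
  by split=> // [a b -> ->|a b ->]; rewrite ?addr0 ?mulr0.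
by move=> n /red.
Qed.

End PrimeAvoidance.

Section AffineSections.
Variables (A : comPzRingType) (U : set (rspec A)) (f : lsec (@rgerms A) U).
Variable t : A.
Hypothesis redA : ring_reduced A.
Hypothesis tU : forall P : rspec A, ~ P t -> U P.

(** Points where [b] vanishes are left unconstrained, so fractions valid near one point and
    fractions valid on all of [D(t)] fall under the same notion. *)
Definition represents (a b : A) := forall P (UP : U P) (Pb : ~ P b),
  ~ P t -> f P UP = rfrac a Pb.

(** Expanding the local fraction by [g] makes its denominator vanish outside the neighbourhood
    [D(g)] on which the formula is known. *)
Lemma represents_local (P : rspec A) : ~ P t -> exists a b, ~ P b /\ represents a b.
Proof.
move=> /tU UP; have [[a b] [W [oW WP Wb e]]] := lsecP f UP.
have [g Pg gW] := (rspec_openP W).1 oW P WP; have /= Pb := Wb _ WP.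
exists (a * g), (b * g); split; first exact: rprimeM.
move=> Q UQ Qbg _; have Qg := rprimeMr Qbg.
rewrite (e Q UQ (rprimeMl Qbg) (gW Q Qg)) /=; apply/rfracP.
by exists 1; [exact: rprime1|ring].
Qed.

(** The factor [t * b * d] lies in every prime where one of the representations says nothing; at the
    others, equality of germs puts the last factor in the prime. Reducedness then gives
    vanishing. *)
Lemma represents_cross a b c d : represents a b -> represents c d ->
  t * b * d * (a * d - c * b) = 0.
Proof.
move=> ab cd; apply: eq0_of_primes => // P; apply: contrapT => Ph.
have Ptbd := rprimeMl Ph; have Pd := rprimeMr Ptbd; have Ptb := rprimeMl Ptbd.
have Pt := rprimeMl Ptb; have Pb := rprimeMr Ptb.
have := ab P (tU Pt) Pb Pt; rewrite (cd P (tU Pt) Pd Pt) => /rfracP[u Pu e].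
apply: (rprimeM Pu (rprimeMr Ph)).
have -> : u * (a * d - c * b) = 0 by rewrite mulrBr e subrr.
exact: rprime0.
Qed.

(* The usual argument: the denominators [t b^2] of local representations generate
   an ideal containing a power of [t], and the same linear combination of the
   numerators [t a b] is the numerator of a global representation. *)
Lemma affine_section : exists a n, represents a (t ^+ n).
Proof.
pose I : set A := [set x | exists y, forall a b, represents a b ->
  x * (t * a * b) = y * (t * b * b)].
have idI : ring_ideal I.
  split=> [|x x' [y e] [y' e']|z x [y e]]; first by exists 0 => a b _; ring.
    by exists (y + y') => a b ab; rewrite !mulrDl e // e'.
  by exists (z * y) => a b ab; rewrite -!(mulrA z) e.
have [n [y e]] : exists n, I (t ^+ n).
  apply: contrapT => h.
  have [n nI|P IP Pt] := rprime_avoid idI (t := t); first by apply: h; exists n.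
  have [a [b [Pb ab]]] := represents_local Pt.
  apply: (rprimeM (rprimeM Pt Pb) Pb); apply: IP.
  (* This numerator shows that [t * b * b] lies in [I]: the required identity is, up to sign, [t]
     times the cross relation. *)
  exists (t * a * b) => c d cd; apply/eqP; rewrite -subr_eq0; apply/eqP.
  transitivity (- (t * (t * b * d * (a * d - c * b)))); first by ring.
  by rewrite represents_cross ?mulr0 ?oppr0.
exists y, n => P UP Ptn Pt; have [a [b [Pb ab]]] := represents_local Pt.
rewrite (ab P UP Pb Pt); apply/rfracP; exists (t * b); first exact: rprimeM.
transitivity (t ^+ n * (t * a * b)); first by ring.
by rewrite e //; ring.
Qed.

End AffineSections.

Lemma rfrac_eq_mul (A : comPzRingType) (P : rspec A) (t a b s s' : A)
    (Ps : ~ P s) (Ps' : ~ P s') :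
  ~ P t -> t * a = t * b -> s = s' -> rfrac a Ps = rfrac b Ps'.
Proof.
by move=> Pt e ss; apply/rfracP; exists t; rewrite // !mulrA e ss.
Qed.

Lemma rfrac1P (A : comPzRingType) (P : rspec A) (a b : A) :
  rfrac a (@rprime1 A P) = rfrac b (@rprime1 A P) -> exists2 u, ~ P u & a * u = b * u.
Proof. by move=> /rfracP[u Pu]; rewrite !mulr1 ![u * _]mulrC; exists u. Qed.

Lemma rfrac1M (A : comPzRingType) (P : rspec A) (a b s : A) (Ps : ~ P s) :
  rfrac a (@rprime1 A P) * rfrac b Ps = rfrac (a * b) Ps.
Proof. by rewrite rfracM; apply/rfracP; exists 1; [exact: rprime1|rewrite !mul1r]. Qed.

Lemma rfrac_eq_prime (A : comPzRingType) (P : rspec A) (c d a b s t : A)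
    (Ps : ~ P s) (Pt : ~ P t) :
  rfrac (c * a) Ps = rfrac (d * b) Pt -> P (c * (a * t) - d * (b * s)).
Proof.
move=> /rfracP[u Pu e]; have [_ _ Pp] := rspecP P.
have [|//|//] := Pp u (c * (a * t) - d * (b * s)).
by rewrite mulrBr !(mulrA c) !(mulrA d) e subrr; apply: rprime0.
Qed.

(** * Monomials and combinatorial primes *)

Section Contraction.
Variables (K : fieldType) (M : binoidType).
Implicit Types (P : rspec (binalg K M)) (q : bspec M) (mu nu : M).

Lemma binTX mu n : binT K mu ^+ n = binT K (mu *+ n).
Proof.
by elim: n => [|n IH]; rewrite ?mulr0n ?binT0 // exprS IH binTM mulrS.
Qed.

Lemma binT_eq0 mu : binT K mu = 0 -> mu = binf.
Proof.
move=> e; apply: contrapT => /eqP mu0.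
have /eqP := binT_coeff K mu (exist _ mu mu0).
by rewrite e mcoeff0 eqxx eq_sym oner_eq0.
Qed.

Lemma bin_idealTP q mu : bin_ideal K q (binT K mu) <-> q mu.
Proof.
split=> [/bin_idealP h|]; last exact: bin_idealT.
have [->|mu0] := eqVneq mu binf; first exact: bprime_inf.
by apply: (h (exist _ mu mu0)); rewrite binT_coeff eqxx oner_eq0.
Qed.

Lemma bin_ideal_sub_coeff (I : set M) (f g : binalg K M) (nu : binoid_pt M) :
  bin_ideal K I (f - g) -> ~ I (val nu) -> f@_nu = g@_nu.
Proof.
move=> /bin_idealP /(_ nu); rewrite mcoeffB => h nI; apply/eqP; rewrite -subr_eq0.
by apply: contrapT => /negP /h.
Qed.

Lemma contraction_prime P : binoid_prime [set mu | P (binT K mu)].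
Proof.
have [[_ _ PM] _ Pp] := rspecP P; split.
- split=> [|a x Px] /=; first by rewrite binT_inf; apply: rprime0.
  by rewrite -binTM; apply: PM.
- by move=> /seteqP[_ /(_ 0 I)] /=; rewrite binT0; apply: rprime1.
by move=> a b /=; rewrite -binTM => /Pp.
Qed.

Definition contraction P : bspec M := BSpec (contraction_prime P).

(** Powers of [T^mu] are nonzero as [M] is reduced, so prime avoidance applies in [K[M]]; the
    contraction of the prime found misses [mu]. *)
Lemma bprime_avoid mu : binoid_reduced M -> mu <> binf -> exists q, ~ q mu.
Proof.
move=> red mu0; have [||P _ Pmu] := @rprime_avoid _ [set 0] (binT K mu).
- by split=> // [a b -> ->|a b ->]; rewrite ?addr0 ?mulr0.
- move=> n /=; rewrite binTX => /binT_eq0.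
  case: n => [|n /red h]; last exact/mu0/h.
  by rewrite mulr0n => e0; apply: mu0; rewrite -[mu]addr0 e0 addrbinf.
by exists (contraction P).
Qed.

Lemma binalg_eq0 (h : binalg K M) : binoid_reduced M ->
  (forall q, bin_ideal K q h) -> h = 0.
Proof.
move=> red hq; apply/malgP => nu; rewrite mcoeff0; apply/eqP; apply: contrapT.
move=> /negP hnu; have [q qnu] := bprime_avoid red (elimN eqP (valP nu)).
by apply/qnu/(bin_idealP q h).1.
Qed.

(** If [q] contains [mu], the factor [T^mu] is already in [K[q]]. So the product lies in every
    [K[q]], and these intersect in zero. *)
Lemma mul_binT_eq0 mu (h : binalg K M) : binoid_reduced M ->
  (forall q, ~ q mu -> bin_ideal K q h) -> binT K mu * h = 0.
Proof.
move=> red hq; apply: binalg_eq0 => // q.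
have [qI _ _] := bspecP q; have [_ _ IM] := bin_ideal_ideal K qI.
have [qmu|/hq] := pselect (q mu); last exact: IM.
by rewrite mulrC; apply/IM/bin_idealT.
Qed.

Lemma binalg_reduced : binoid_reduced M -> binoid_cancellative M ->
  binoid_torsion_free M -> ring_reduced (binalg K M).
Proof.
move=> red can tf h n hn; apply: binalg_eq0 => // q.
by apply: (@rprimeX _ (spec_map K can tf q) h n); rewrite hn; apply: rprime0.
Qed.

End Contraction.

(** * Factors of a monomial modulo a combinatorial prime *)

Section MonomialFactors.
Variables (K : fieldType) (M : binoidType).
Hypothesis can : binoid_cancellative M.
Hypothesis tf : binoid_torsion_free M.
Variable q : bspec M.
Implicit Types (R : M -> M -> Prop) (f g : binalg K M) (a b mu nu : binoid_pt M).

Lemma good_opp R : good q R -> good q (fun x y => R y x).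
Proof.
move=> gR; split.
- by move=> x y /(good_dom gR)[].
- exact: good_irr gR.
- by move=> y x z xy yz; apply: good_trans gR _ _ _ yz xy.
- by move=> a x y; apply: good_add gR _ _ _.
- by move=> a x y; apply: good_can gR _ _ _.
by move=> n x y; apply: good_div gR _ _ _.
Qed.

(** Monomials in [q] are disregarded since [f] matters only modulo [K[q]]. As [R] may be partial,
    comparability with [a] is part of the notion. *)
Definition leading R f a := [/\ f@_a != 0, ~ q (val a) &
  forall nu, f@_nu != 0 -> ~ q (val nu) -> R (val nu) (val a) \/ nu = a].

(** Two monomials with sum [val a + val b] lie outside [q], since their sum does. If either were
    strictly below its leading monomial, translation invariance would make the sum strictly smaller,
    so no other pair contributes. *)
Lemma leading_mul R f g a b : good q R -> leading R f a -> leading R g b ->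
  forall rho : binoid_pt M, val rho = val a + val b -> (f * g)@_rho = f@_a * g@_b.
Proof.
move=> gR [fa qa la] [gb qb lb] rho rhoE.
have uni mu nu : f@_mu != 0 -> g@_nu != 0 -> val mu + val nu = val a + val b ->
    mu = a /\ nu = b.
  move=> fmu gnu e; have qmn : ~ q (val mu + val nu) by rewrite e; apply: bprimeD.
  have [qm qn] := (bprimeDl qmn, bprimeDr qmn).
  have irr : ~ R (val mu + val nu) (val a + val b) by rewrite e; apply: (good_irr gR).
  have [ma|ma] := la mu fmu qm; have [nb|nb] := lb nu gnu qn; last by [].
  - case: irr; apply: (good_trans gR (y := val mu + val b)); first exact: (good_add gR).
    by rewrite ![_ + val b]addrC; apply: (good_add gR).
  - by case: irr; rewrite nb ![_ + val b]addrC; apply: (good_add gR).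
  - by case: irr; rewrite ma; apply: (good_add gR).
rewrite binalgM_coeff rhoE (bigD1_seq a) ?mcoeff_neq0 ?fset_uniq //=;
  last by rewrite -mcoeff_neq0.
rewrite (bigD1_seq b) ?fset_uniq //=; last by rewrite -mcoeff_neq0.
rewrite eqxx mulr1 [X in _ + X]big_seq_cond [X in _ + X]big1 => [|mu]; last first.
  rewrite -mcoeff_neq0 => /andP[fmu /eqP na]; rewrite big_seq big1 // => nu.
  rewrite -mcoeff_neq0 => gnu; case: eqP => [/(uni _ _ fmu gnu)[]//|].
  by rewrite mulr0.
rewrite big_seq_cond big1 ?addr0 // => nu.
rewrite -mcoeff_neq0 => /andP[gnu /eqP nb]; case: eqP => [/(uni _ _ fa gnu)[]//|].
by rewrite mulr0.
Qed.

Definition support_off f :=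
  [seq x <- [seq val nu | nu <- msupp f] | `[< ~ q x >]].

Lemma support_offP f x : reflect
  (exists2 nu : binoid_pt M, f@_nu != 0 & x = val nu /\ ~ q x) (x \in support_off f).
Proof.
rewrite mem_filter; apply: (iffP andP).
  by move=> [/asboolP qx /mapP[nu nuf xE]]; exists nu; rewrite ?mcoeff_neq0.
move=> [nu fnu [-> qnu]]; split; first exact/asboolP.
by apply/mapP; exists nu => //; rewrite -mcoeff_neq0.
Qed.

Lemma support_off0 f : ~ bin_ideal K q f -> support_off f != [::].
Proof.
apply: contra_notN => /eqP e; apply/bin_idealP => nu fnu; apply: contrapT => qnu.
by have : val nu \in support_off f; [apply/support_offP; exists nu|rewrite e].
Qed.

Definition compared_on R f := forall x y, x \in support_off f -> y \in support_off f ->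
  compared R (x, y).

Lemma leading_exists R f : good q R -> compared_on R f -> ~ bin_ideal K q f ->
  exists a, leading R f a.
Proof.
move=> gR cR /support_off0 f0; have [x /support_offP[a fa [-> qa]] la] := good_max gR f0 cR.
exists a; split=> // nu fnu qnu; case: (la (val nu)).
- by apply/support_offP; exists nu.
- by left.
by move=> /val_inj; right.
Qed.

(* For an order comparing the monomials of [f] and [g] outside [q], both the
   product of the largest ones and that of the smallest ones survive in [f * g]. *)
Lemma monomial_factor f g (k : M) : ~ q k -> f * g = binT K k ->
  exists a, [/\ f@_a != 0, (exists b, val a + val b = k) &
    forall nu, f@_nu != 0 -> ~ q (val nu) -> nu = a].
Proof.
move=> qk fg; have [qI _ _] := bspecP q; have [_ _ IM] := bin_ideal_ideal K qI.
have nf : ~ bin_ideal K q f.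
  by move=> qf; apply: qk; rewrite -(bin_idealTP K) -fg mulrC; apply: IM.
have ng : ~ bin_ideal K q g.
  by move=> qg; apply: qk; rewrite -(bin_idealTP K) -fg; apply: IM.
have [R gR cR] : exists2 R, good q R & compared_on R f /\ compared_on R g.
  pose sq h := [seq (x, y) | x <- support_off h, y <- support_off h].
  have [xy|R gR hR] := @good_total _ can tf q (sq f ++ sq g).
    rewrite mem_cat => /orP[] /allpairsP[[x y] /=].
      by move=> [/support_offP[? _ [_ ?]] /support_offP[? _ [_ ?]] ->].
    by move=> [/support_offP[? _ [_ ?]] /support_offP[? _ [_ ?]] ->].
  exists R => //; split=> x y hx hy; apply: hR; rewrite mem_cat.
    by rewrite (allpairs_f _ hx hy).
  by rewrite [X in _ || X](allpairs_f _ hx hy) orbT.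
(* The coefficient of the product at [val a + val b] is nonzero, so this monomial must be [k]. This
   is applied to [R] and to its opposite. *)
have ext S : good q S -> compared_on S f -> compared_on S g ->
    exists a b, [/\ leading S f a, leading S g b & val a + val b = k].
  move=> gS cf cg; have [a la] := leading_exists gS cf nf.
  have [b lb] := leading_exists gS cg ng; exists a, b; split=> //.
  have [[fa qa _] [gb qb _]] := (la, lb).
  have ab : val a + val b != binf.
    by apply/eqP => e; apply: (bprimeD qa qb); rewrite e; apply: bprime_inf.
  have := leading_mul gS la lb (rho := exist _ (val a + val b : M) ab) erefl.
  rewrite fg binT_coeff /=; case: eqP => [->//|_ /esym/eqP].
  by rewrite mulf_eq0 (negbTE fa) (negbTE gb).
have [cf cg] := cR; have [a [b [[fa qa la] [gb qb lb] ab]]] := ext R gR cf cg.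
have cop h : compared_on R h -> compared_on (fun x y => R y x) h.
  by move=> ch x y hx hy; case: (ch x y hx hy) => ?; [apply: Or32|apply: Or31|apply: Or33].
have [c [d [[fc qc lc] [gd qd ld] cd]]] := ext _ (good_opp gR) (cop _ cf) (cop _ cg).
(* Here [a] is largest and [c] smallest; a strict inequality between them would give
   [c + d < a + b], but both sums are [k]. *)
have ac : a = c.
  have [ca|//] := la c fc qc; exfalso.
  suff : R (val c + val d) (val a + val b) by rewrite cd ab => /(good_irr gR).
  have lt : R (val c + val d) (val a + val d).
    by rewrite ![_ + val d]addrC; apply: (good_add gR).
  have [db|<-//] := lb d gd qd.
  by apply: (good_trans gR lt); apply: (good_add gR).
rewrite -ac in lc; exists a; split=> // [|nu fnu qnu]; first by exists b.
have [na|//] := la nu fnu qnu; have [an|//] := lc nu fnu qnu.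
by case: (good_irr gR (x := val a)); apply: good_trans gR _ _ _ an na.
Qed.
End MonomialFactors.

(** * Local form of units *)

(** The sum of the generators outside [p] works: a prime missing it misses each of them, and an
    element outside [p] is a combination of these alone. *)
Lemma minimal_nbhd (M : binoidType) (p : bspec M) : binoid_fg M ->
  exists2 mu, ~ p mu & forall q : bspec M, ~ q mu -> q `<=` p.
Proof.
move=> [s sM]; exists (\sum_(x <- s | `[< ~ p x >]) x).
  by elim/big_ind: _ => [|x y|x /asboolP//]; [exact: bprime0|exact: bprimeD].
move=> q qmu; have sq x : x \in s -> ~ p x -> ~ q x.
  move=> xs /asboolP px qx; apply: qmu.
  rewrite (big_rem x) //= px addrC; have [[_ qD] _ _] := bspecP q; exact: qD.
move=> x; apply: contraPP => px; have [e|[k e]] := sM x.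
  by case: px; rewrite e; apply: bprime_inf.
have ps (i : 'I_(size s)) : ~ p (s`_i *+ k i) by move: px; rewrite e (bigD1 i) //= => /bprimeDl.
rewrite e; elim/big_ind: _ => [|y z|i _]; [exact: bprime0|exact: bprimeD|].
(* A generator of multiplicity 0 may lie in [p]; it contributes only [0], which no prime
   contains. *)
have := ps i; case: (k i) => [|n]; first by rewrite mulr0n => _; apply: bprime0.
rewrite mulrS => /bprimeDl psi; rewrite -mulrS; apply: bprimeMn.
exact/sq/psi/mem_nth.
Qed.

Lemma scaler_inj_or0 (K : fieldType) (V : lmodType K) (c d : K) (v : V) :
  c *: v = d *: v -> c = d \/ v = 0.
Proof.
move=> /eqP; rewrite -subr_eq0 -scalerBl scaler_eq0 subr_eq0.
by case/orP => /eqP; [left|right].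
Qed.

Section Constants.
Variables (K : fieldType) (M : binoidType).
Implicit Types (c d : K) (f : binalg K M).

Definition binC c : binalg K M := c *: binT K 0.

Lemma binCE c f : c *: f = binC c * f.
Proof. by rewrite -{1}[f]mul1r binalg_scaleAl. Qed.

Lemma binC1 : binC 1 = 1.
Proof. exact: scale1r. Qed.

Lemma binCM c d : binC (c * d) = binC c * binC d.
Proof. by rewrite -binCE /binC scalerA. Qed.

Lemma binC_mul_eq c d f : binC c * f = binC d * f -> c = d \/ f = 0.
Proof.
move=> e; apply: (@scaler_inj_or0 K (binalg K M)).
exact: etrans (binCE c f) (etrans e (esym (binCE d f))).
Qed.

Lemma binC_binT_coeff c (m : M) (nu : binoid_pt M) :
  (binC c * binT K m)@_nu = c * (m == val nu)%:R.
Proof. by rewrite -binCE mcoeffZ binT_coeff. Qed.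

End Constants.

Arguments binC {K} M c.

Section UnitLocal.
Variables (K : fieldType) (M : binoidType).
Hypothesis fgM : binoid_fg M.
Hypothesis red : binoid_reduced M.
Hypothesis can : binoid_cancellative M.
Hypothesis tf : binoid_torsion_free M.
Implicit Types (P : rspec (binalg K M)) (p q : bspec M) (mu : M).

(** Keeping [T^m] outside [P] records that the fraction is invertible; at the points [K[q]] this
    allows exponents to be compared. *)
Definition monomial_on (U : set (rspec (binalg K M))) (f : rsec U)
    (c : K) (m n mu : M) :=
  forall P, ~ P (binT K mu) -> ~ P (binT K m) /\
    exists Pn : ~ P (binT K n), forall UP : U P, f P UP = rfrac (binC M c * binT K m) Pn.

Lemma unit_monomial_on (U : set (rspec (binalg K M))) (f g : rsec U) p :
  f * g = 1 -> (exists2 mu, ~ p mu & forall P, ~ P (binT K mu) -> U P) ->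
  exists c m n mu, [/\ c != 0, ~ p mu & monomial_on f c m n mu].
Proof.
move=> fg [mu0 pmu0 mu0U]; have [mu1 pmu1 mu1p] := minimal_nbhd p fgM.
(* [mu0] keeps the neighbourhood inside [U]; [mu1] forces each [q] missing [mu] to be contained in
   [p]. *)
pose mu := mu0 + mu1; pose t := binT K mu.
have pmu : ~ p mu by apply: bprimeD.
have tU P : ~ P t -> U P by rewrite /t -binTM => /rprimeMl/mu0U.
have qp q : ~ q mu -> q `<=` p by move=> /bprimeDr/mu1p.
have redA := binalg_reduced (K := K) red can tf.
have [a [n an]] := affine_section f redA tU.
have [b [n' bn']] := affine_section g redA tU.
have tab : t * (a * b - t ^+ (n + n')) = 0.
  apply: eq0_of_primes redA _ => P; apply: contrapT => Ph.
  have Pt := rprimeMl Ph; have UP := tU P Pt.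
  have PX k : ~ P (t ^+ k) by move=> /rprimeX.
  have := congr1 (fun s : rsec U => s P UP) fg.
  rewrite /= (an P UP (PX n) Pt) (bn' P UP (PX n') Pt) [LHS]rfracM.
  move=> /rfracP[u Pu]; rewrite mulr1 mul1r -exprD => e.
  apply: (rprimeM Pu (rprimeMr Ph)); rewrite mulrBr e subrr; exact: rprime0.
(* The successor accounts for the factor [t] in [tab]. *)
pose k := mu *+ (n + n').+1.
have abk : a * (t * b) = binT K k.
  rewrite /k -binTX exprS -/t; apply/eqP; rewrite -subr_eq0; apply/eqP.
  by rewrite -[RHS]tab; ring.
have pk : ~ p k by apply: bprimeMn.
have [a0 [aa0 [b0 ab0] a0p]] := monomial_factor can tf pk abk.
have pa0 : ~ p (val a0) by move: pk; rewrite -ab0 => /bprimeDl.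
(* At each [q] missing [mu], [a] reduces to a single monomial [a1] modulo [K[q]]. As [a1] divides
   [k], it is outside [p], so uniqueness at [p] identifies it with [a0]. *)
have ta : t * (a - a@_a0 *: binT K (val a0)) = 0.
  apply: mul_binT_eq0 => // q qmu; apply/bin_idealP => nu; apply: contraNP => qnu.
  rewrite mcoeffB mcoeffZ binT_coeff.
  have qk : ~ q k by apply: bprimeMn.
  have [a1 [aa1 [b1 ab1] a1q]] := monomial_factor can tf qk abk.
  have pa1 : ~ p (val a1) by move: pk; rewrite -ab1 => /bprimeDl.
  have [->|n0] := eqVneq nu a0; first by rewrite eqxx mulr1 subrr.
  rewrite [val a0 == _]eq_sym (inj_eq val_inj) (negbTE n0) mulr0 subr0.
  apply: contraNT n0 => anu; apply/eqP.
  by rewrite (a1q nu anu qnu) (a0p a1 aa1 pa1).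
(* Adding [val a0] to [mu] makes the numerator invertible on the neighbourhood. *)
exists (a@_a0), (val a0), (mu *+ n), (mu + val a0); split=> //; first exact: bprimeD.
move=> P; rewrite -binTM => Pm; split; first exact: rprimeMr Pm.
have Pt := rprimeMl Pm.
have Pn : ~ P (binT K (mu *+ n)) by rewrite -binTX => /rprimeX.
exists Pn => UP; have Ptn : ~ P (t ^+ n) by rewrite binTX.
have {}ta : t * a = t * (binC M (a@_a0) * binT K (val a0)).
  by rewrite -binCE; apply/eqP; rewrite -subr_eq0 -mulrBr ta.
by rewrite (an P UP Ptn Pt); apply: (rfrac_eq_mul _ _ Pt ta); apply: binTX.
Qed.

End UnitLocal.

(** * Germs of monomials *)

Section MonomialGerms.
Variables (K : fieldType) (M : binoidType) (p : bspec M) (P : rspec (binalg K M)).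
Hypothesis pP : forall mu, ~ p mu -> ~ P (binT K mu).

Definition cst_germ (c : K) : rloc P := rfrac (binC M c) (@rprime1 _ P).

Lemma cst_germM c d : cst_germ (c * d) = cst_germ c * cst_germ d.
Proof.
by rewrite /cst_germ binCM rfrac1M.
Qed.

Lemma cst_germ1 : cst_germ 1 = 1.
Proof. by rewrite /cst_germ binC1. Qed.

Lemma cst_germ_inj : injective cst_germ.
Proof.
move=> c d /rfrac1P[u Pu /binC_mul_eq[//|u0]].
by case: Pu; rewrite u0; apply: rprime0.
Qed.

Definition bloc_germ (x : bloc p) : rloc P :=
  rfrac (binT K (bloc_num x)) (pP (@bloc_denP _ _ x)).

(** Independence of the chosen representative: the multiplier [u] relating two fractions is outside
    [p], so [T^u] is outside [P]. *)
Lemma bloc_germE m s (ps : ~ p s) (Ps : ~ P (binT K s)) :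
  bloc_germ (bfrac m ps) = rfrac (binT K m) Ps.
Proof.
apply/rfracP; have /bfracP[u pu e] := bloc_frac (bfrac m ps).
by exists (binT K u); [exact: pP|rewrite !binTM e].
Qed.

Lemma cst_bloc_germE c m s (ps : ~ p s) (Ps : ~ P (binT K s)) :
  cst_germ c * bloc_germ (bfrac m ps) = rfrac (binC M c * binT K m) Ps.
Proof. by rewrite (bloc_germE m ps Ps) rfrac1M. Qed.

Lemma bloc_germ0 : bloc_germ 0 = 1.
Proof. by rewrite (bloc_germE _ _ (pP (@bprime0 _ p))); apply: rfrac_irr. Qed.

Lemma bloc_germD : {morph bloc_germ : x y / x + y >-> x * y}.
Proof.
elim/blocW => m s ps; elim/blocW => n t pt; rewrite bfracD.
rewrite (bloc_germE _ _ (pP ps)) (bloc_germE _ _ (pP pt)) rfracM binTM.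
rewrite (bloc_germE _ _ (pP (bprimeD ps pt))); apply: (rfrac_eq_mul _ _ (@rprime1 _ P)) => //.
by rewrite binTM.
Qed.

Lemma bloc_unit_num m s (ps : ~ p s) (y : bloc p) : bfrac m ps + y = 0 -> ~ p m.
Proof.
elim/blocW: y => n t pt; rewrite bfracD => /bfracP[u pu]; rewrite addr0 add0r => e.
have : ~ p (u + (m + n)) by rewrite e; apply: bprimeD pu (bprimeD ps pt).
by move=> /bprimeDr/bprimeDl.
Qed.

End MonomialGerms.

Section GermsAtMonomialPrimes.
Variables (K : fieldType) (M : binoidType).
Hypothesis can : binoid_cancellative M.
Hypothesis tf : binoid_torsion_free M.
Variable q : bspec M.

Lemma spec_map_out mu : ~ q mu -> ~ spec_map K can tf q (binT K mu).
Proof. by move=> qmu /bin_idealTP. Qed.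

(** The cross difference lies in [K[q]], so it has no monomial outside [q]. But [m + t] is outside
    [q] and carries [c], hence the other term must cancel it. *)
Lemma rfrac_binT_inj (c d : K) m n s t
    (Qs : ~ spec_map K can tf q (binT K s)) (Qt : ~ spec_map K can tf q (binT K t)) :
    c != 0 -> ~ q m ->
  rfrac (binC M c * binT K m) Qs = rfrac (binC M d * binT K n) Qt -> c = d /\ m + t = n + s.
Proof.
move=> c0 qm /rfrac_eq_prime; rewrite (binTM K m t) (binTM K n s) => h.
have qt : ~ q t by move=> /(bin_idealTP K).
have qmt : ~ q (m + t) by apply: bprimeD.
have mt0 : m + t != binf by apply/eqP => e; apply: qmt; rewrite e; apply: bprime_inf.
pose mt : binoid_pt M := exist _ (m + t) mt0.
have := etrans (esym (binC_binT_coeff c (m + t) mt))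
  (etrans (bin_ideal_sub_coeff (nu := mt) h qmt) (binC_binT_coeff d (n + s) mt)).
rewrite /= eqxx mulr1.
case: eqP => [->|_]; first by rewrite mulr1.
by rewrite mulr0 => c00; rewrite c00 eqxx in c0.
Qed.

Lemma bloc_germ_inj (c d : K) (x x' y : bloc q) : c != 0 -> x + x' = 0 ->
  cst_germ (spec_map K can tf q) c * bloc_germ spec_map_out x =
  cst_germ (spec_map K can tf q) d * bloc_germ spec_map_out y -> c = d /\ x = y.
Proof.
elim/blocW: x => m s qs; elim/blocW: y => n t qt c0 /bloc_unit_num qm.
move=> e; have := etrans (esym (cst_bloc_germE spec_map_out c m qs (spec_map_out qs)))
  (etrans e (cst_bloc_germE spec_map_out d n qt (spec_map_out qt))).
move=> /rfrac_binT_inj[]//.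
by move=> -> mn; split=> //; apply/bfracP; exists 0; [exact: bprime0|rewrite mn].
Qed.

End GermsAtMonomialPrimes.

(** * The comparison morphism *)

(** This allows the morphism to start from the direct sum, where it has an explicit formula. *)
Lemma absheaf_isomorphic_sym (X : topologicalType) (F G : absheaf X) :
  absheaf_isomorphic F G -> absheaf_isomorphic G F.
Proof.
move=> [phi [phiD phi_bij phi_res]].
have inv U : {g | cancel (phi U) g /\ cancel g (phi U)}.
  by apply: cid; have [g phiK gK] := phi_bij U; exists g.
have phiK U := (svalP (inv U)).1; have gK U := (svalP (inv U)).2.
exists (fun U => sval (inv U)); split=> [U s t|U|U V h s].
- by apply: (can_inj (phiK U)); rewrite phiD !gK.
- by exists (phi U).
by apply: (can_inj (phiK V)); rewrite phi_res !gK.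
Qed.

Lemma bspec_eq (M : binoidType) (p q : bspec M) : (forall x, p x <-> q x) -> p = q.
Proof.
case: p q => p hp [q hq] /= pq; have {}pq : p = q by apply/funext => x; apply/propext.
by move: pq hp hq => -> hp hq; congr BSpec; apply: Prop_irrelevance.
Qed.

Section Comparison.
Variables (K : fieldType) (M : binoidType).
Hypothesis can : binoid_cancellative M.
Hypothesis tf : binoid_torsion_free M.
Implicit Types (P Q : rspec (binalg K M)) (q : bspec M) (mu : M).
Let i := spec_map K can tf.

Lemma contraction_spec_map q : contraction (i q) = q.
Proof. by apply: bspec_eq => x; apply: bin_idealTP. Qed.

Lemma contraction_open (W : set (bspec M)) : open W ->
  open [set P : rspec (binalg K M) | W (contraction P)].
Proof.
move=> /bspec_openP oW; apply/rspec_openP => P /oW[mu Pmu muW].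
by exists (binT K mu) => // Q Qmu; apply: muW.
Qed.

Lemma comb_contraction (U : opens (cspec K M)) P : U P -> U (i (contraction P)).
Proof.
have /cspec_openP oU := osetP U; move=> /oU[mu Pmu muU].
by apply: muU => /bin_idealTP.
Qed.

Variable U : opens (cspec K M).
Let UR : opens (rspec (binalg K M)) := preimo (@to_cspec_continuous K M) U.
Let UB : opens (bspec M) := preimo (spec_map_continuous K can tf) UR.

Lemma out_contraction P mu : ~ contraction P mu -> ~ P (binT K mu).
Proof. by []. Qed.

(** A fraction [m - n] valid on [W] becomes [T^m / T^n] on the preimage of [W] under contraction,
    which is Zariski open. *)
Lemma mono_sec_local (s : bsec UB) : @is_local _ _ (@rgerms (binalg K M)) UR
  (fun P UP => bloc_germ (@out_contraction P) (s (contraction P) (comb_contraction UP))).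
Proof.
move=> P UP; have [[m n] [W [oW WP Wn e]]] := lsecP s (comb_contraction UP).
exists (binT K m, binT K n), [set P | W (contraction P)]; split=> //.
- exact: contraction_open.
- by move=> Q /Wn.
move=> Q UQ Qn WQ; rewrite (e _ _ (Wn _ WQ) WQ); exact: bloc_germE.
Qed.

Definition mono_sec (s : bsec UB) : mulmon (rsec UR) := LSec (mono_sec_local s).

Lemma mono_sec_morph : nmod_morphism mono_sec.
Proof.
split=> [|s t]; apply: lsec_eq => P UP; first exact: bloc_germ0.
exact: bloc_germD.
Qed.

Lemma mono_sec_spec_map (s : bsec UB) q (Uq : UB q) (Uiq : UR (i q)) :
  lsec_val (mono_sec s) Uiq = bloc_germ (@spec_map_out K M can tf q) (s q Uq).
Proof.
(* Both proofs mention [contraction (i q)], which equals [q] only propositionally, so they are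
   generalised before rewriting. *)
rewrite /=; move: (comb_contraction Uiq) (@out_contraction (i q)).
rewrite contraction_spec_map => Uq' out.
by rewrite (Prop_irrelevance Uq' Uq) (Prop_irrelevance out (@spec_map_out K M can tf q)).
Qed.

Definition cst_sec_val (c : const_sec (munits (mulmon K)) UR) P (UP : UR P) : rloc P :=
  cst_germ P (munits_val (c P UP)).

Lemma cst_sec_local (c : const_sec (munits (mulmon K)) UR) :
  @is_local _ _ (@rgerms (binalg K M)) UR (cst_sec_val c).
Proof.
move=> P UP; have [k [W [oW WP _ e]]] := lsecP c UP.
exists (binC M (munits_val k), 1), W; split=> //.
  by move=> Q _; apply: rprime1.
move=> Q UQ Q1 WQ; rewrite /cst_sec_val (e _ _ I WQ); exact: rfrac_irr.
Qed.

Definition cst_sec (c : const_sec (munits (mulmon K)) UR) : mulmon (rsec UR) :=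
  LSec (cst_sec_local c).

Lemma cst_sec0 : cst_sec 0 = 0.
Proof. apply: lsec_eq => P UP; exact: cst_germ1. Qed.

Lemma cst_secD : {morph cst_sec : c d / c + d}.
Proof. move=> c d; apply: lsec_eq => P UP; exact: cst_germM. Qed.

Lemma cst_sec_unit (c : const_sec (munits (mulmon K)) UR) : exists y, cst_sec c + y = 0.
Proof. by exists (cst_sec (- c)); rewrite -cst_secD subrr cst_sec0. Qed.

Definition unit_of_pair (sc : units_sheaf (bstruct_sheaf M) UB *
    constant_sheaf (rspec (binalg K M)) (munits (mulmon K)) UR) :
    units_sheaf (rstruct_sheaf_mul (binalg K M)) UR :=
  munits_map mono_sec_morph sc.1 + MUnits (cst_sec_unit sc.2).

End Comparison.

Lemma mulmon_add_val (A : comPzRingType) (U : set (rspec A)) (s t : mulmon (rsec U))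
    P (UP : U P) :
  lsec_val (s + t : mulmon (rsec U)) UP = lsec_val (s : rsec U) UP * lsec_val (t : rsec U) UP.
Proof. by []. Qed.

Lemma mulmon0_val (A : comPzRingType) (U : set (rspec A)) P (UP : U P) :
  lsec_val (0 : mulmon (rsec U)) UP = 1.
Proof. by []. Qed.

Lemma mulIr_inv (A : comPzRingType) (x y a b : A) : x * y = 1 -> a * x = b * x -> a = b.
Proof. by move=> xy e; rewrite -[a]mulr1 -[b]mulr1 -xy !mulrA e. Qed.

(** * Injectivity of the comparison morphism *)

Section Bijectivity.
Variables (K : fieldType) (M : binoidType).
Hypothesis can : binoid_cancellative M.
Hypothesis tf : binoid_torsion_free M.
Implicit Types (P Q : rspec (binalg K M)) (q : bspec M) (mu : M).
Let i := spec_map K can tf.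
Variable U : opens (cspec K M).
Let UR : opens (rspec (binalg K M)) := preimo (@to_cspec_continuous K M) U.
Let UB : opens (bspec M) := preimo (spec_map_continuous K can tf) UR.

Lemma munits_mulmon_neq0 (k : munits (mulmon K)) : (munits_val k : K) != 0.
Proof.
have [y e] := munitsP k; apply/eqP => k0; have /eqP : (munits_val k : K) * y = 1 := e.
by rewrite k0 mul0r eq_sym oner_eq0.
Qed.

Definition units_of_neq0 (c : K) (c0 : c != 0) : munits (mulmon K) :=
  @MUnits (mulmon K) c (ex_intro _ (c^-1 : mulmon K) (mulfV c0)).

Lemma unit_of_pair_val s c P (UP : UR P) :
  lsec_val (munits_val (unit_of_pair (can := can) (tf := tf) (U := U) (s, c))) UP =
  cst_germ P (munits_val (lsec_val c UP)) * lsec_val (mono_sec (munits_val s)) UP.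
Proof.
exact: etrans (mulmon_add_val (mono_sec (munits_val s)) (cst_sec c) UP) (mulrC _ _).
Qed.

(** The binoid parts are compared at the points [K[q]]. Their common image is invertible, so it
    cancels at every [P], which leaves the constants. *)
Lemma unit_of_pair_inj : injective (@unit_of_pair K M can tf U).
Proof.
move=> [s c] [s' c'] e.
have ev P (UP : UR P) := etrans (esym (unit_of_pair_val s c UP))
  (etrans (congr1 (fun z : munits (mulmon (rsec UR)) =>
      lsec_val (munits_val z : rsec UR) UP) e) (unit_of_pair_val s' c' UP)).
have [y sy] := munitsP s.
have es : s = s'.
  apply: munits_inj; apply: lsec_eq => q Uq.
  have sq : lsec_val (munits_val s : bsec UB) Uq + lsec_val (y : bsec UB) Uq = 0.
    exact: (congr1 (fun z : bsec UB => lsec_val z Uq) sy).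
  have := ev (i q) Uq; rewrite !(mono_sec_spec_map _ Uq).
  by move=> /(bloc_germ_inj (munits_mulmon_neq0 _) sq)[].
suff -> : c = c' by rewrite es.
apply: lsec_eq => P UP; apply: munits_inj.
apply: (@cst_germ_inj _ _ P).
have := ev P UP; rewrite -es.
have : lsec_val (mono_sec (munits_val s)) UP * lsec_val (mono_sec (y : bsec UB)) UP = 1.
  have [m0 mD] := @mono_sec_morph K M can tf U.
  have := congr1 (fun z : rsec UR => lsec_val z UP) (mD (munits_val s) (y : bsec UB)).
  rewrite mulmon_add_val => <-; rewrite sy m0; exact: mulmon0_val.
move=> h e0; exact: (mulIr_inv h e0).
Qed.

End Bijectivity.

(** * Surjectivity of the comparison morphism *)

Section Surjectivity.
Variables (K : fieldType) (M : binoidType).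
Hypothesis fgM : binoid_fg M.
Hypothesis red : binoid_reduced M.
Hypothesis can : binoid_cancellative M.
Hypothesis tf : binoid_torsion_free M.
Implicit Types (P Q : rspec (binalg K M)) (q : bspec M) (mu : M).
Let i := spec_map K can tf.

Lemma monomial_on_out (V : set (rspec (binalg K M))) (f : rsec V) c m n mu q :
  monomial_on f c m n mu -> ~ q mu -> ~ q m /\ ~ q n.
Proof.
move=> mf qmu; have [Pm [Pn _]] := mf (i q) (@spec_map_out K M can tf q mu qmu).
by split=> h; [apply: Pm|apply: Pn]; apply/bin_idealTP.
Qed.

(** Both forms hold at [K[q]], where constants and exponents can be read off. This makes independent
    choices of local forms compatible. *)
Lemma monomial_on_uniq (V : set (rspec (binalg K M))) (f : rsec V)
    c m n mu d m' n' mu' q : V (i q) -> c != 0 ->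
  monomial_on f c m n mu -> ~ q mu -> monomial_on f d m' n' mu' -> ~ q mu' ->
  c = d /\ m + n' = m' + n.
Proof.
move=> Vq c0 mf qmu mf' qmu'; have [qm _] := monomial_on_out mf qmu.
have [_ [Pn e]] := mf (i q) (@spec_map_out K M can tf q mu qmu).
have [_ [Pn' e']] := mf' (i q) (@spec_map_out K M can tf q mu' qmu').
exact: rfrac_binT_inj c0 qm (etrans (esym (e Vq)) (e' Vq)).
Qed.

Variable U : opens (cspec K M).
Let UR : opens (rspec (binalg K M)) := preimo (@to_cspec_continuous K M) U.
Let UB : opens (bspec M) := preimo (spec_map_continuous K can tf) UR.

Lemma unit_monomial_form (f g : mulmon (rsec UR)) : f + g = 0 ->
  exists (s : bsec UB) (c : const_sec (munits (mulmon K)) UR), forall P (UP : UR P),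
    lsec_val (f : rsec UR) UP =
    cst_germ P (munits_val (lsec_val c UP)) * lsec_val (mono_sec s : rsec UR) UP.
Proof.
move=> fg.
pose form q (w : K * M * M * M) := let: (c, m, n, mu) := w in
  [/\ c != 0, ~ q mu & monomial_on (f : rsec UR) c m n mu].
have ex q : UB q -> exists w, form q w.
  move=> Uq; have /cspec_openP oU := osetP U; have [mu Pmu muU] := oU _ Uq.
  have qmu : ~ q mu by move=> /(bin_idealTP K).
  have [|c [m [n [mu' h]]]] :=
      unit_monomial_on fgM red can tf (p := q) (fg : (f : rsec UR) * g = 1).
    by exists mu.
  by exists (c, m, n, mu').
pose w q (Uq : UB q) := sval (cid (ex q Uq)).
have wP q (Uq : UB q) : form q (w q Uq) := svalP (cid (ex q Uq)).
pose cK q Uq := (w q Uq).1.1.1; pose m q Uq := (w q Uq).1.1.2.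
pose n q Uq := (w q Uq).1.2; pose mu q Uq := (w q Uq).2.
have wc q Uq : cK q Uq != 0 by have := wP q Uq; rewrite /cK; case: (w q Uq) => [[[? ?] ?] ?] [].
have wmu q Uq : ~ q (mu q Uq) by have := wP q Uq; rewrite /mu; case: (w q Uq) => [[[? ?] ?] ?] [].
have wf q Uq : monomial_on (f : rsec UR) (cK q Uq) (m q Uq) (n q Uq) (mu q Uq).
  by have := wP q Uq; rewrite /cK /m /n /mu; case: (w q Uq) => [[[? ?] ?] ?] [].
clearbody cK m n mu; clear w wP ex form.
have wn q Uq : ~ q (n q Uq) := (monomial_on_out (wf q Uq) (wmu q Uq)).2.
(* The form chosen at [q] remains valid at [q'], where it is compared with the form chosen at
   [q']. *)
have coh q Uq q' (Uq' : UB q') : ~ q' (mu q Uq) ->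
    cK q' Uq' = cK q Uq /\ m q' Uq' + n q Uq = m q Uq + n q' Uq'.
  move=> qmu; exact: monomial_on_uniq Uq' (wc q' Uq') (wf _ _) (wmu _ _) (wf _ _) qmu.
have s_local : @is_local _ _ (bgerms M) UB (fun q Uq => bfrac (m q Uq) (wn q Uq)).
  move=> q Uq; exists (m q Uq, n q Uq), (bspec_D (mu q Uq)); split.
  - exact: bspec_D_open.
  - exact: wmu.
  - by move=> q' /(monomial_on_out (wf q Uq))[].
  move=> q' Uq' q'n /(coh q Uq q' Uq')[_ e]; apply/bfracP.
  by exists 0; [exact: bprime0|rewrite e].
(* The constant at [P] is the one chosen at its contraction; by coherence it does not change on
   [D(T^mu)], for the [mu] chosen there. *)
have c_local : @is_local _ _ (const_germs (rspec (binalg K M)) (munits (mulmon K))) UR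
    (fun P UP => units_of_neq0 (wc (contraction P) (comb_contraction can tf UP))).
  move=> P UP; pose UBP := comb_contraction can tf UP.
  exists (units_of_neq0 (wc _ UBP)), [set Q : rspec (binalg K M) | ~ Q (binT K (mu _ UBP))]; split.
  - exact: rspec_Df_open.
  - exact: (wmu _ UBP).
  - by [].
  move=> Q UQ QT Qmu; apply: munits_inj => /=.
  by have [] := coh _ UBP (contraction Q) (comb_contraction can tf UQ) Qmu.
exists (LSec s_local), (LSec c_local) => P UP.
set Uq := comb_contraction can tf UP.
have [_ [Pn e]] := wf _ Uq P (wmu _ Uq); apply: etrans (e UP) _.
exact: esym (cst_bloc_germE _ _ _ _ _).
Qed.

Lemma unit_of_pair_surj (f : units_sheaf (rstruct_sheaf_mul (binalg K M)) UR) :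
  exists sc, @unit_of_pair K M can tf U sc = f.
Proof.
have [g fg] := munitsP f; have gf : g + munits_val f = 0 by rewrite addrC.
have [s [c fE]] := unit_monomial_form fg.
have [s' [c' gE]] := unit_monomial_form gf.
have [mono0 monoD] := @mono_sec_morph K M can tf U.
(* The form of [f] alone does not exhibit an inverse of [s]. The forms of [f] and [g] multiply to 1,
   and comparison with the trivial form of 1 at [K[q]] shows that [s'] is one. *)
have ss' : s + s' = 0.
  apply: lsec_eq => q Uq.
  have : cst_germ (i q) (munits_val (lsec_val (c + c') (Uq : UR (i q)))) *
      lsec_val (mono_sec (s + s') : rsec UR) (Uq : UR (i q)) = 1.
    have := congr1 (fun z : mulmon (rsec UR) => lsec_val (z : rsec UR) (Uq : UR (i q))) fg.
    rewrite mulmon_add_val (fE _ Uq) (gE _ Uq) mulmon0_val => <-.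
    by rewrite monoD mulmon_add_val cst_germM mulrACA.
  rewrite (mono_sec_spec_map _ Uq) => h.
  have e1 : cst_germ (i q) 1 * bloc_germ (@spec_map_out K M can tf q) 0 = 1.
    by rewrite cst_germ1 bloc_germ0 mulr1.
  by have [_ <-] := bloc_germ_inj (oner_neq0 K) (addr0 0) (etrans e1 (esym h)).
exists (@MUnits (bsec UB) s (ex_intro _ s' ss'), c).
apply: munits_inj; apply: lsec_eq => P UP.
by rewrite unit_of_pair_val fE.
Qed.

End Surjectivity.

(** * Compatibility with restriction *)

Section CombRestriction.
Variables (K : fieldType) (M : binoidType).
Hypothesis can : binoid_cancellative M.
Hypothesis tf : binoid_torsion_free M.
Variables (U V : opens (cspec K M)) (h : V `<=` U) (P : rspec (binalg K M)).
Let UR : opens (rspec (binalg K M)) := preimo (@to_cspec_continuous K M) U.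
Let VR : opens (rspec (binalg K M)) := preimo (@to_cspec_continuous K M) V.
Variables (VP : VR P) (UP : UR P).

(* [preimo_sub] is opaque, so the two sides differ by a proof of [U P]. *)
Lemma comb_units_res_val (x : comb (units_sheaf (rstruct_sheaf_mul (binalg K M))) U) :
  lsec_val (munits_val (abres h x) : rsec VR) VP = lsec_val (munits_val x : rsec UR) UP.
Proof. by congr (lsec_val (munits_val x) _); apply: Prop_irrelevance. Qed.

Lemma comb_const_res_val
    (c : comb (constant_sheaf (rspec (binalg K M)) (munits (mulmon K))) U) :
  lsec_val (abres h c : const_sec (munits (mulmon K)) VR) VP =
  lsec_val (c : const_sec (munits (mulmon K)) UR) UP.
Proof. by congr (lsec_val c _); apply: Prop_irrelevance. Qed.

Lemma comb_mono_sec_res_val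
    (s : comb (pushforward (spec_map_continuous K can tf) (units_sheaf (bstruct_sheaf M))) U) :
  lsec_val (@mono_sec K M can tf V (munits_val (abres h s)) : rsec VR) VP =
  lsec_val (@mono_sec K M can tf U (munits_val s) : rsec UR) UP.
Proof.
by congr (bloc_germ _ (lsec_val (munits_val s) _)); apply: Prop_irrelevance.
Qed.

End CombRestriction.

Theorem proposition3p23 (K : fieldType) (M : binoidType)
    (M_fg : binoid_fg M) (M_reduced : binoid_reduced M)
    (M_torsion_free : binoid_torsion_free M)
    (M_cancellative : binoid_cancellative M) :
  absheaf_isomorphic
    (comb (units_sheaf (rstruct_sheaf_mul (binalg K M))))
    (dsum
       (comb (pushforward (spec_map_continuous K M_cancellative M_torsion_free)
                (units_sheaf (bstruct_sheaf M))))
       (comb (constant_sheaf (rspec (binalg K M)) (munits (mulmon K))))).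
Proof.
apply: absheaf_isomorphic_sym.
exists (@unit_of_pair K M M_cancellative M_torsion_free); split=> [U x y|U|U V h x].
- apply: munits_inj; have [_ monoD] := @mono_sec_morph K M M_cancellative M_torsion_free U.
  rewrite /= monoD cst_secD; exact: addrACA.
- have surj y := cid (@unit_of_pair_surj K M M_fg M_reduced M_cancellative M_torsion_free U y).
  exists (fun y => sval (surj y)) => [x|y]; last exact: svalP (surj y).
  exact: unit_of_pair_inj (svalP (surj _)).
apply: munits_inj; apply: lsec_eq => P VP; case: x => s c.
apply: etrans (unit_of_pair_val _ _ VP) _.
apply: etrans _ (esym (comb_units_res_val h VP (h P VP) (unit_of_pair (s, c)))).
apply: etrans _ (esym (unit_of_pair_val s c (h P VP))).
change (s, c).1 with s; change (s, c).2 with c.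
by rewrite (comb_const_res_val h VP (h P VP)) (comb_mono_sec_res_val h VP (h P VP)).
Qed.
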